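(* Let $\mathcal{I}_k=[0,b_k)$, $0<b_k\le\infty$ ($k=1,2$). Let $$G(x,t,z)=-\sum_{k=0}^r z^kq_k(x,t)-\sum_{s=1}^l\sum_{k=1}^{r_s}(z-c_s)^{-k}q_{sk}(x,t),$$ $$F(x,t,z)=-\sum_{k=0}^R z^kQ_k(x,t)-\sum_{s=1}^L\sum_{k=1}^{R_s}(z-C_s)^{-k}Q_{sk}(x,t),$$ where the coefficients are $m\times m$ matrix functions on $\mathcal{I}_1\times\mathcal{I}_2$ such that: $\{q_k\}$, $\{q_{sk}\}$ are differentiable with respect to $t$; $\{Q_k\}$, $\{Q_{sk}\}$ are differentiable with respect to $x$; the matrix functions $\{q_k\}$, $\{q_{sk}\}$, $\{Q_k\}$, $\{Q_{sk}\}$, $\{\frac{\partial}{\partial t}q_k\}$, $\{\frac{\partial}{\partial t}q_{sk}\}$ are continuous with respect to $x$ and $t$; and the zero curvature equation $G_t-F_x+[G,F]=0$ holds on $\mathcal{I}_1\times\mathcal{I}_2$. Let $A_1,A_2$ be $n\times n$ matrices with $\{c_s\}\cap\sigma(A_k)=\emptyset$ and $\{C_s\}\cap\sigma(A_k)=\emptyset$ ($k=1,2$), and let $\Pi_1(x,t)$, $\Pi_2(x,t)$ ($n\times m$) and $S(x,t)$ ($n\times n$) be matrix functions on $\mathcal{I}_1\times\mathcal{I}_2$ satisfying $$A_1S(0,0)-S(0,0)A_2=\Pi_1(0,0)\Pi_2(0,0)^*$$ and the equations $$(\Pi_1)_x=\sum_{k=0}^rA_1^k\Pi_1q_k+\sum_{s=1}^l\sum_{k=1}^{r_s}(A_1-c_sI_n)^{-k}\Pi_1q_{sk},$$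 $$(\Pi_2^* )_x=-\Big(\sum_{k=0}^rq_k\Pi_2^*A_2^k+\sum_{s=1}^l\sum_{k=1}^{r_s}q_{sk}\Pi_2^*(A_2-c_sI_n)^{-k}\Big),$$ $$S_x=\sum_{k=1}^r\sum_{j=1}^kA_1^{k-j}\Pi_1q_k\Pi_2^*A_2^{j-1}-\sum_{s=1}^l\sum_{k=1}^{r_s}\sum_{j=1}^k(A_1-c_sI_n)^{j-k-1}\Pi_1q_{sk}\Pi_2^*(A_2-c_sI_n)^{-j},$$ $$(\Pi_1)_t=\sum_{k=0}^RA_1^k\Pi_1Q_k+\sum_{s=1}^L\sum_{k=1}^{R_s}(A_1-C_sI_n)^{-k}\Pi_1Q_{sk},$$ $$(\Pi_2^* )_t=-\Big(\sum_{k=0}^RQ_k\Pi_2^*A_2^k+\sum_{s=1}^L\sum_{k=1}^{R_s}Q_{sk}\Pi_2^*(A_2-C_sI_n)^{-k}\Big),$$ $$S_t=\sum_{k=1}^R\sum_{j=1}^kA_1^{k-j}\Pi_1Q_k\Pi_2^*A_2^{j-1}-\sum_{s=1}^L\sum_{k=1}^{R_s}\sum_{j=1}^k(A_1-C_sI_n)^{j-k-1}\Pi_1Q_{sk}\Pi_2^*(A_2-C_sI_n)^{-j}.$$ Let $\mathcal{D}_S=\{(x,t)\in\mathcal{I}_1\times\mathcal{I}_2:\ \det S(x,t)\ne0\}$, and let $\widetilde G$, $\widetilde F$, with coefficients $\{\widetilde q_k\},\{\widetilde q_{sk}\}$ and $\{\widetilde Q_k\},\{\widetilde Q_{sk}\}$,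 be the transformed matrix functions on $\mathcal{D}_S$ defined in the context. Then the coefficients $\{\widetilde q_k\}$, $\{\widetilde q_{sk}\}$ of $\widetilde G$ and $\{\widetilde Q_k\}$, $\{\widetilde Q_{sk}\}$ of $\widetilde F$ are continuous on $\mathcal{D}_S$ together with the derivatives $\{\frac{\partial}{\partial t}\widetilde q_k\}$ and $\{\frac{\partial}{\partial t}\widetilde q_{sk}\}$. Moreover, the zero curvature equation $$\widetilde G_t-\widetilde F_x+[\widetilde G,\widetilde F]=0$$ holds on $\mathcal{D}_S$.
   Context: All matrices are complex; $\sigma(A)$ is the spectrum of $A$; $[G,F]:=GF-FG$; subscripts $x,t$ attached to matrix functions denote partial derivatives (one-sided at boundary points); $I_n$ is the $n\times n$ identity; $c_s,C_s\in\mathbb{C}$; $z$ is a complex spectral parameter, and the equations involving $z$ are understood for all $z$ different from the poles $c_s$, $C_s$. Definition of $\widetilde G$ and $\widetilde F$ (at points where $S$ is invertible): $$\widetilde G(x,t,z)=-\sum_{k=0}^rz^k\widetilde q_k(x,t)-\sum_{s=1}^l\sum_{k=1}^{r_s}(z-c_s)^{-k}\widetilde q_{sk}(x,t),$$ $$\widetilde q_k=q_k-\sum_{j=k+1}^r\Big(q_jY_{j-k-1}-X_{j-k-1}q_j+\sum_{i=k+2}^jX_{j-i}q_jY_{i-k-2}\Big),$$ $$\widetilde q_{sk}=q_{sk}+\sum_{j=k}^{r_s}\Big(q_{sj}Y_{s,k-j-1}-X_{s,k-j-1}q_{sj}-\sum_{i=k}^jX_{s,i-j-1}q_{sj}Y_{s,k-i-1}\Big),$$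 where $$X_k=\Pi_2^*S^{-1}A_1^k\Pi_1,\quad X_{s,k}=\Pi_2^*S^{-1}(A_1-c_sI_n)^k\Pi_1,$$ $$Y_k=\Pi_2^*A_2^kS^{-1}\Pi_1,\quad Y_{s,k}=\Pi_2^*(A_2-c_sI_n)^kS^{-1}\Pi_1 .$$ Similarly, $$\widetilde F(x,t,z)=-\sum_{k=0}^Rz^k\widetilde Q_k(x,t)-\sum_{s=1}^L\sum_{k=1}^{R_s}(z-C_s)^{-k}\widetilde Q_{sk}(x,t),$$ where $\widetilde Q_k$, $\widetilde Q_{sk}$ are given by the same formulas with $q_k,q_{sk},r,r_s,l,c_s$ replaced by $Q_k,Q_{sk},R,R_s,L,C_s$ respectively (in particular $X_{s,k}$, $Y_{s,k}$ are then formed with $C_s$ in place of $c_s$). *)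

(* Defs.v *)
From HB Require Import structures.
From mathcomp Require Import all_boot all_order all_algebra.
From mathcomp Require Import all_classical all_reals all_analysis.
From mathcomp Require Export complex.
Set Implicit Arguments.
Unset Strict Implicit.
Unset Printing Implicit Defensive.
Import Order.TTheory GRing.Theory Num.Theory numFieldNormedType.Exports.
Local Open Scope classical_set_scope.
Local Open Scope complex_scope.
Local Open Scope sesquilinear_scope.
Local Open Scope ring_scope.

(* The library puts the norm topology on every abstract [numClosedFieldType],
   but not on the concrete type [R[i]]; matrices over [R[i]] then carry the
   entrywise topology. *)
HB.instance Definition _ (R : realType) := NormedModule.copy R[i] R[i]^o.

(* Integer powers of a matrix of arbitrary size ([exprz] is only available for
   sizes of the form [n.+1]). Negative powers are meaningful for invertible
   matrices only. *)
Definition mxexpz (K : fieldType) (n : nat) (B : 'M[K]_n) (k : int) : 'M[K]_n :=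
  match k with
  | Posz j => B ^+ j
  | Negz j => invmx B ^+ j.+1
  end.

Section PartialDerivatives.
Variables (R : realType) (D : set (R * R)).
Variables (m n : nat).
Implicit Types (f : R * R -> 'M[R[i]]_(m, n)) (p : R * R) (l : 'M[R[i]]_(m, n)).

(* [is_dx D f p l] : the partial derivative of [f] in the first variable at
   [p] is [l], the limit being taken inside [D] (so it is one-sided at the
   boundary points of [D]). *)
Definition is_dx f p l : Prop :=
  ((y - p.1)%:C)^-1 *: (f (y, p.2) - f p)
    @[y --> within [set y | D (y, p.2)] p.1^'] --> l.

Definition is_dt f p l : Prop :=
  ((y - p.2)%:C)^-1 *: (f (p.1, y) - f p)
    @[y --> within [set y | D (p.1, y)] p.2^'] --> l.

Definition differentiable_x f : Prop := forall p, D p -> exists l, is_dx f p l.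

Definition C1_t f : Prop :=
  exists f', (forall p, D p -> is_dt f p (f' p)) /\ {within D, continuous f'}.

End PartialDerivatives.

Section Domains.
Variable R : realType.

Definition domain (b1 b2 : \bar R) : set (R * R) :=
  [set p | (0 <= p.1 /\ (p.1%:E < b1)%E) /\ (0 <= p.2 /\ (p.2%:E < b2)%E)].

Definition regular_points (n : nat) (D : set (R * R))
    (S : R * R -> 'M[R[i]]_n) : set (R * R) :=
  D `&` [set p | \det (S p) != 0].

End Domains.

(* The data of a rational matrix function
     - \sum_(k <= r) z ^ k q_k - \sum_s \sum_(1 <= k <= r_s) (z - c_s) ^ -k q_sk
   with coefficients depending on [(x, t)]. Only the values [coef k] with
   [k <= deg] and [pcoef s k] with [1 <= k <= mult s] are relevant. *)
Record ratmx (R : realType) (m : nat) := RatMx {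
  deg : nat;
  npoles : nat;
  pole : 'I_npoles -> R[i];
  mult : 'I_npoles -> nat;
  coef : nat -> R * R -> 'M[R[i]]_m;
  pcoef : 'I_npoles -> nat -> R * R -> 'M[R[i]]_m
}.

Section RationalMatrixFunctions.
Variables (R : realType) (m : nat).
Implicit Types G F : ratmx R m.

Definition ratmx_eval G (z : R[i]) (p : R * R) : 'M[R[i]]_m :=
  - (\sum_(0 <= k < (deg G).+1) z ^+ k *: coef G k p)
  - \sum_(s < npoles G) \sum_(1 <= k < (mult s).+1)
      (z - pole s) ^- k *: pcoef s k p.

Definition all_coefs (P : (R * R -> 'M[R[i]]_m) -> Prop) G : Prop :=
  (forall k, (k <= deg G)%N -> P (coef G k)) /\
  (forall (s : 'I_(npoles G)) k, (1 <= k <= mult s)%N -> P (pcoef s k)).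

Definition poles_avoid_spectrum G (n : nat) (A : 'M[R[i]]_n) : Prop :=
  forall s : 'I_(npoles G), ~~ eigenvalue A (pole s).

(* [G_t - F_x + [G, F] = 0] on [D], including the existence of the two partial
   derivatives. *)
Definition zero_curvature (D : set (R * R)) G F : Prop :=
  forall (z : R[i]) (p : R * R),
    (forall s : 'I_(npoles G), z != pole s) ->
    (forall s : 'I_(npoles F), z != pole s) ->
    D p ->
    exists Gt Fx : 'M[R[i]]_m,
      [/\ is_dt D (ratmx_eval G z) p Gt,
          is_dx D (ratmx_eval F z) p Fx
        & Gt - Fx + (ratmx_eval G z p *m ratmx_eval F z p
                     - ratmx_eval F z p *m ratmx_eval G z p) = 0].

Variable n : nat.
Variables (A1 A2 : 'M[R[i]]_n) (Pi1 Pi2 : R * R -> 'M[R[i]]_(n, m)).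
Variable S : R * R -> 'M[R[i]]_n.

(* Right-hand sides of the linear equations for [Pi1], [Pi2 ^t*] and [S]; they
   are the x-equations for [G] and the t-equations for [F]. *)
Definition rhs_Pi1 G (p : R * R) : 'M[R[i]]_(n, m) :=
  \sum_(0 <= k < (deg G).+1) A1 ^+ k *m Pi1 p *m coef G k p
  + \sum_(s < npoles G) \sum_(1 <= k < (mult s).+1)
      mxexpz (A1 - (pole s)%:M) (- k%:Z) *m Pi1 p *m pcoef s k p.

Definition rhs_Pi2 G (p : R * R) : 'M[R[i]]_(m, n) :=
  - (\sum_(0 <= k < (deg G).+1) coef G k p *m (Pi2 p) ^t* *m A2 ^+ k
     + \sum_(s < npoles G) \sum_(1 <= k < (mult s).+1)
         pcoef s k p *m (Pi2 p) ^t* *m mxexpz (A2 - (pole s)%:M) (- k%:Z)).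

Definition rhs_S G (p : R * R) : 'M[R[i]]_n :=
  \sum_(1 <= k < (deg G).+1) \sum_(1 <= j < k.+1)
    A1 ^+ (k - j) *m Pi1 p *m coef G k p *m (Pi2 p) ^t* *m A2 ^+ (j - 1)
  - \sum_(s < npoles G) \sum_(1 <= k < (mult s).+1) \sum_(1 <= j < k.+1)
      mxexpz (A1 - (pole s)%:M) (j%:Z - k%:Z - 1) *m Pi1 p *m pcoef s k p
        *m (Pi2 p) ^t* *m mxexpz (A2 - (pole s)%:M) (- j%:Z).

Definition trX (k : nat) (p : R * R) : 'M[R[i]]_m :=
  (Pi2 p) ^t* *m invmx (S p) *m A1 ^+ k *m Pi1 p.

Definition trXpole (c : R[i]) (k : int) (p : R * R) : 'M[R[i]]_m :=
  (Pi2 p) ^t* *m invmx (S p) *m mxexpz (A1 - c%:M) k *m Pi1 p.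

Definition trY (k : nat) (p : R * R) : 'M[R[i]]_m :=
  (Pi2 p) ^t* *m A2 ^+ k *m invmx (S p) *m Pi1 p.

Definition trYpole (c : R[i]) (k : int) (p : R * R) : 'M[R[i]]_m :=
  (Pi2 p) ^t* *m mxexpz (A2 - c%:M) k *m invmx (S p) *m Pi1 p.

(* All subtractions of natural numbers below are exact on the summation
   ranges. *)
Definition tr_coef G (k : nat) (p : R * R) : 'M[R[i]]_m :=
  coef G k p
  - \sum_(k.+1 <= j < (deg G).+1)
      (coef G j p *m trY (j - k - 1) p - trX (j - k - 1) p *m coef G j p
       + \sum_(k.+2 <= i < j.+1)
           trX (j - i) p *m coef G j p *m trY (i - k - 2) p).

Definition tr_pcoef G (s : 'I_(npoles G)) (k : nat) (p : R * R) : 'M[R[i]]_m :=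
  let X := trXpole (pole s) in
  let Y := trYpole (pole s) in
  pcoef s k p
  + \sum_(k <= j < (mult s).+1)
      (pcoef s j p *m Y (k%:Z - j%:Z - 1) p
       - X (k%:Z - j%:Z - 1) p *m pcoef s j p
       - \sum_(k <= i < j.+1)
           X (i%:Z - j%:Z - 1) p *m pcoef s j p *m Y (k%:Z - i%:Z - 1) p).

(* The transformed function ([G] with tilde); it is meaningful at the points
   where [S] is invertible. *)
Definition transform G : ratmx R m :=
  RatMx (deg G) (@pole R m G) (@mult R m G) (tr_coef G) (@tr_pcoef G).

End RationalMatrixFunctions.

(* Main.v *)
Require Import Defs.
From mathcomp Require Import all_boot all_order all_algebra.
From mathcomp Require Import all_classical all_reals all_analysis.
From mathcomp Require Import ring lra zify.
Import Order.TTheory GRing.Theory Num.Theory numFieldNormedType.Exports.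
Local Open Scope classical_set_scope.
Local Open Scope complex_scope.
Local Open Scope sesquilinear_scope.
Local Open Scope ring_scope.
Set Implicit Arguments.
Unset Strict Implicit.
Unset Printing Implicit Defensive.

(** Put [P := Pi2 ^t*] and [T := S^-1]. The proof transports the zero curvature
    equation through the Darboux matrix
      [W(x, t, z) = 1 - P T (A1 - z)^-1 Pi1].

    Algebra. The x- and t-equations preserve [A1 S - S A2 - Pi1 P], so the
    identity [A1 S - S A2 = Pi1 P] propagates from the origin to the whole
    domain ([operator_identity]). The function [G] is a sum of monomials
    [g(z) M] with [g(z) = z ^ k] or [(z - c_s) ^ - k], up to sign;
    [Pi1_x] and [P_x] are built with the values [g(A1)] and [g(A2)], [S_x] with
    the divided difference [g[A1, A2]], and the transformed function with
    [g[A1, z]], [g[A2, z]] and [g[A1, A2, z]]. Since these divided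
    differences satisfy [(A1 - z) g[A1, z] = g(A1) - g(z)] and the like, and
    since the operator identity gives [T Pi1 W = (A2 - z) T (A1 - z)^-1 Pi1],
    they cancel monomial by monomial and leave [W_x = Gtilde W - W G]
    ([darboux_term], [darboux_rhs]); in the same way [W_t = Ftilde W - W F].
    Moreover [W] is invertible when [z] avoids the spectra of [A1] and [A2]
    ([mul_WV]). Equating the two mixed derivatives of [W] then turns
    [G_t - F_x + [G, F] = 0] into the transformed equation
    ([zero_curvature_transport]) for such [z]; as both sides are rational in [z]
    with the same poles as [G] and [F], it extends to all other [z] by
    continuity.

    Analysis. Only the existence of partial derivatives of [Pi1], [P], [S] is
    assumed. Their joint continuity follows from the linear growth of the
    x-equations, whose coefficients are continuous, by a local Gronwall argument
    ([joint_continuity]). Continuity, continuity with a continuous t-derivative,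
    and x-differentiability are all stable under sums and products
    ([mxclass]), hence they pass to the transformed coefficients on the relatively open set where [S] is invertible. For the
    mixed derivatives of [W], the t-derivative of [Gtilde W - W G] is continuous
    while the x-derivative of [Ftilde W - W F] is only known to exist; this
    asymmetric situation is covered by [mixed_partials], which rests on the
    mean value inequality [mean_value_ineq]. *)

(** * The l1 norm of complex matrices *)

Section EntrywiseNorm.
Variable R : realType.
Implicit Types (z w : R[i]) (m n k : nat).

Definition cl1 z : R := `|complex.Re z| + `|complex.Im z|.

(** Real-valued and submultiplicative, so that limits of matrix products reduce
    to real limits. *)
Definition mxl1 m n (A : 'M[R[i]]_(m, n)) : R := \sum_i \sum_j cl1 (A i j).

Lemma cl1_ge0 z : 0 <= cl1 z.
Proof. by rewrite addr_ge0. Qed.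

Lemma cl1D z w : cl1 (z + w) <= cl1 z + cl1 w.
Proof.
rewrite /cl1 !raddfD /= addrACA.
by case: z w => [a b] [c d] /=; apply: lerD; apply: ler_normD.
Qed.

Lemma cl1M z w : cl1 (z * w) <= cl1 z * cl1 w.
Proof.
case: z w => [a b] [c d]; rewrite /cl1 /=.
apply: (@le_trans _ _ ((`|a * c| + `|b * d|) + (`|a * d| + `|b * c|))).
  by apply: lerD; rewrite ?ler_normB ?ler_normD.
by rewrite !normrM mulrDl !mulrDr; lra.
Qed.

Lemma cl1_sum I (r : seq I) (P : pred I) (f : I -> R[i]) :
  cl1 (\sum_(i <- r | P i) f i) <= \sum_(i <- r | P i) cl1 (f i).
Proof.
elim/big_rec2: _ => [|i x y _ h]; first by rewrite /cl1 /= normr0 addr0.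
by apply: le_trans (cl1D _ _) _; rewrite lerD2l.
Qed.

Lemma mxl1_ge0 m n (A : 'M[R[i]]_(m, n)) : 0 <= mxl1 A.
Proof. by apply: sumr_ge0 => i _; apply: sumr_ge0 => j _; apply: cl1_ge0. Qed.

Lemma cl1_le_mxl1 m n (A : 'M[R[i]]_(m, n)) i j : cl1 (A i j) <= mxl1 A.
Proof.
rewrite /mxl1 (bigD1 i) //= (bigD1 j) //= -addrA lerDl addr_ge0 //.
  by apply: sumr_ge0 => ? _; apply: cl1_ge0.
by apply: sumr_ge0 => ? _; apply: sumr_ge0 => ? _; apply: cl1_ge0.
Qed.

Lemma mxl1_eq0 m n (A : 'M[R[i]]_(m, n)) : mxl1 A <= 0 -> A = 0.
Proof.
move=> h; apply/matrixP => i j; rewrite mxE.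
have := le_trans (cl1_le_mxl1 A i j) h.
case: (A i j) => a b; rewrite /cl1 /= => h0.
have /eqP : `|a| + `|b| = 0 by apply/le_anti; rewrite h0 addr_ge0.
by rewrite paddr_eq0 // !normr_eq0 => /andP[/eqP-> /eqP->].
Qed.

Lemma mxl10 m n : mxl1 (0 : 'M[R[i]]_(m, n)) = 0.
Proof.
rewrite /mxl1 big1 // => i _; rewrite big1 // => j _.
by rewrite mxE /cl1 /= normr0 addr0.
Qed.

Lemma mxl1D m n (A B : 'M[R[i]]_(m, n)) : mxl1 (A + B) <= mxl1 A + mxl1 B.
Proof.
rewrite /mxl1 -big_split; apply: ler_sum => i _.
by rewrite -big_split; apply: ler_sum => j _; rewrite mxE cl1D.
Qed.

Lemma mxl1N m n (A : 'M[R[i]]_(m, n)) : mxl1 (- A) = mxl1 A.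
Proof.
apply: eq_bigr => i _; apply: eq_bigr => j _; rewrite mxE /cl1.
by case: (A i j) => a b /=; rewrite !normrN.
Qed.

Lemma mxl1B m n (A B : 'M[R[i]]_(m, n)) : mxl1 (A - B) = mxl1 (B - A).
Proof. by rewrite -mxl1N opprB. Qed.

Lemma mxl1M m n k (A : 'M[R[i]]_(m, n)) (B : 'M[R[i]]_(n, k)) : mxl1 (A *m B) <= mxl1 A * mxl1 B.
Proof.
rewrite mulr_suml; apply: ler_sum => i _.
rewrite mulr_suml.
apply: (@le_trans _ _ (\sum_j \sum_l cl1 (A i l) * cl1 (B l j))).
  apply: ler_sum => j _; rewrite mxE; apply: le_trans (cl1_sum _ _ _) _.
  by apply: ler_sum => l _; apply: cl1M.
rewrite exchange_big /=; apply: ler_sum => l _; rewrite -mulr_sumr.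
apply: ler_wpM2l; first exact: cl1_ge0.
rewrite /mxl1 (bigD1 l) //= lerDl.
by apply: sumr_ge0 => ? _; apply: sumr_ge0 => ? _; apply: cl1_ge0.
Qed.

Lemma mxl1Z m n (c : R) (A : 'M[R[i]]_(m, n)) : mxl1 (c%:C *: A) = `|c| * mxl1 A.
Proof.
rewrite mulr_sumr; apply: eq_bigr => i _; rewrite mulr_sumr.
apply: eq_bigr => j _; rewrite mxE /cl1; case: (A i j) => a b /=.
by rewrite !mul0r subr0 addr0 !normrM mulrDr.
Qed.

Lemma cvgC (T : Type) (F : set_system T) (FF : Filter F) (f : T -> R[i]) z :
  f @ F --> z <-> (fun x => cl1 (f x - z)) @ F --> (0 : R).
Proof.
split=> [/cvgrPdist_lt h|/cvgrPdist_lt h].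
- apply/cvgrPdist_lt => e e0.
  have e20 : 0 < ((e / 2)%:C : R[i]) by rewrite ltcR divr_gt0.
  near=> x; rewrite sub0r normrN ger0_norm ?cl1_ge0 //.
  have : `|z - f x| < (e / 2)%:C by near: x; apply: h.
  rewrite -normrN opprB; set w := f x - z => hw.
  have hRe : `|complex.Re w| < e / 2.
    by rewrite -ltcR; apply: le_lt_trans (normc_ge_Re _) hw.
  have hIm : `|complex.Im w| < e / 2.
    rewrite -ltcR; apply: le_lt_trans hw.
    case: {hRe} w => a b; rewrite normc_def lecR /= -sqrtr_sqr.
    by rewrite ler_sqrt ?addr_ge0 ?sqr_ge0 // lerDr sqr_ge0.
  by rewrite /cl1 [ltRHS](splitr e); apply: ltrD.
- apply/cvgrPdist_lt => e e0.
  have [e' e'0 ee'] : exists2 e' : R, 0 < e' & e'%:C <= e.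
    by move: e0; case: e => a b; rewrite ltcE /= => /andP[/eqP-> a0]; exists a.
  near=> x; rewrite -normrN opprB; apply: lt_le_trans ee'.
  have : cl1 (f x - z) < e'.
    by have := h _ e'0; near: x; apply: filterS (h _ e'0) => x; rewrite sub0r normrN ger0_norm ?cl1_ge0.
  rewrite normc_def ltcR; apply: le_lt_trans; case: (f x - z) => a b; rewrite /cl1 /=.
  rewrite -[leRHS]ger0_norm ?addr_ge0 // -sqrtr_sqr ler_sqrt ?sqr_ge0 //.
  rewrite -(real_normK (num_real a)) -(real_normK (num_real b)).
  by rewrite sqrrD lerD2r lerDl mulrn_wge0 // mulr_ge0.
Unshelve. all: by end_near. Qed.

Lemma cvg_mxP m n (T : Type) (F : set_system T) (FF : Filter F)
    (f : T -> 'M[R[i]]_(m, n)) (L : 'M[R[i]]_(m, n)) :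
  f @ F --> L <-> (fun x => mxl1 (f x - L)) @ F --> (0 : R).
Proof.
split=> [h|h].
- have h2 i j : (fun x => cl1 (f x i j - L i j)) @ F --> (0 : R).
    apply/cvgC => A nA.
    have := h [set M : 'M[R[i]]_(m, n) | A (M i j)]; apply.
    exists (fun i' j' => if (i' == i) && (j' == j) then A else setT).
      move=> i' j'; case: ifP => [/andP[/eqP-> /eqP->]|_]; first exact: nA.
      exact: filterT.
    by move=> M /(_ i j); rewrite !eqxx.
  rewrite (_ : 0 = \sum_(i < m) \sum_(j < n) (0 : R)); last first.
    by apply/esym; apply: big1 => i _; apply: big1.
  rewrite (_ : (fun x => _) = (fun x => \sum_i \sum_j cl1 (f x i j - L i j))).
    do 2!apply: (cvg_big (@add_continuous R)) => ? _; exact: h2.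
  by apply/funext => x; apply: eq_bigr => i _; apply: eq_bigr => j _; rewrite !mxE.
- have h2 i j : (fun x => f x i j) @ F --> L i j.
    apply/cvgC; apply: (squeeze_cvgr _ (cvg_cst 0) h).
    near=> x; rewrite cl1_ge0 /=.
    by have := cl1_le_mxl1 (f x - L) i j; rewrite !mxE.
  move=> A [P nP PA]; rewrite /nbhs /= /filter_from.
  apply: (@filterS _ F _ (fun x => forall i j, P i j (f x i j))).
    by move=> x Px; apply: PA.
  apply: filter_forall => i; apply: filter_forall => j.
  exact: (h2 i j _ (nP i j)).
Unshelve. all: by end_near. Qed.

End EntrywiseNorm.

(** * Limits of matrix functions *)

(** [ring] does not apply to rectangular matrices; here every product becomes an
    atom and the identity is checked entrywise. *)
Ltac mx_lin :=
  repeat match goal with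
  | |- context [?A *m ?B] => let X := fresh "X" in set X := A *m B; clearbody X
  end;
  apply/matrixP => ? ?; rewrite !mxE; ring.

Section MatrixLimits.
Variables (R : realType) (T : Type) (F : set_system T).
Context {FF : Filter F}.

Lemma cvg_mxl1_le m n (f : T -> 'M[R[i]]_(m, n)) (L : 'M[R[i]]_(m, n))
    (g : T -> R) :
  (\forall x \near F, mxl1 (f x - L) <= g x) -> g @ F --> (0 : R) -> f @ F --> L.
Proof.
move=> fg g0; apply/cvg_mxP; apply: (squeeze_cvgr _ (cvg_cst 0) g0).
by apply: filterS fg => x ->; rewrite mxl1_ge0.
Qed.

Lemma cvg_mxD m n (f g : T -> 'M[R[i]]_(m, n)) (L M : 'M[R[i]]_(m, n)) :
  f @ F --> L -> g @ F --> M -> (fun x => f x + g x) @ F --> L + M.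
Proof.
move=> /cvg_mxP fL /cvg_mxP gM.
apply: (cvg_mxl1_le (g := fun x => mxl1 (f x - L) + mxl1 (g x - M))).
  by apply: nearW => x; rewrite opprD addrACA mxl1D.
by rewrite -(addr0 0); apply: cvgD.
Qed.

Lemma cvg_mxM m n k (f : T -> 'M[R[i]]_(m, n)) (g : T -> 'M[R[i]]_(n, k))
    (L : 'M[R[i]]_(m, n)) (M : 'M[R[i]]_(n, k)) :
  f @ F --> L -> g @ F --> M -> (fun x => f x *m g x) @ F --> L *m M.
Proof.
move=> /cvg_mxP fL /cvg_mxP gM.
apply: (cvg_mxl1_le
  (g := fun x => mxl1 (f x - L) * mxl1 (g x - M) +
                 (mxl1 (f x - L) * mxl1 M + mxl1 L * mxl1 (g x - M)))).
  apply: nearW => x.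
  have -> : f x *m g x - L *m M = (f x - L) *m (g x - M) +
      ((f x - L) *m M + L *m (g x - M)).
    by rewrite !mulmxBr !mulmxBl; mx_lin.
  apply: le_trans (mxl1D _ _) _; apply: lerD; first exact: mxl1M.
  by apply: le_trans (mxl1D _ _) _; apply: lerD; apply: mxl1M.
have -> : 0 = 0 * 0 + (0 * mxl1 M + mxl1 L * 0) :> R by rewrite !(mul0r, mulr0) !addr0.
apply: cvgD; first exact: cvgM.
by apply: cvgD; apply: cvgM => //; apply: cvg_cst.
Qed.

Lemma cvg_mxN m n (f : T -> 'M[R[i]]_(m, n)) (L : 'M[R[i]]_(m, n)) :
  f @ F --> L -> (fun x => - f x) @ F --> - L.
Proof.
move=> /cvg_mxP fL; apply: (cvg_mxl1_le (g := fun x => mxl1 (f x - L))) => //.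
by apply: nearW => x; rewrite -opprD mxl1N.
Qed.

Lemma cvg_mx_bounded m n (f : T -> 'M[R[i]]_(m, n)) (L : 'M[R[i]]_(m, n)) :
  f @ F --> L -> \forall x \near F, mxl1 (f x) <= mxl1 L + 1.
Proof.
move=> /cvg_mxP /cvgrPdist_le /(_ 1 ltr01); apply: filterS => x.
rewrite sub0r normrN ger0_norm ?mxl1_ge0 // => h.
by rewrite -(subrK L (f x)) addrC; apply: le_trans (mxl1D _ _) _; rewrite lerD2l.
Qed.

Lemma cvg_mxl1 m n (f : T -> 'M[R[i]]_(m, n)) (L : 'M[R[i]]_(m, n)) :
  f @ F --> L -> (fun x => mxl1 (f x)) @ F --> mxl1 L.
Proof.
move=> /cvg_mxP fL; apply/cvgrPdist_lt => e e0.
apply: filterS (cvgr_lt _ fL _ e0) => x; apply: le_lt_trans.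
have h1 := mxl1D (f x - L) L; have h2 := mxl1D (L - f x) (f x).
move: h1 h2; rewrite !subrK [mxl1 (L - _)]mxl1B => h1 h2.
by rewrite ler_norml; apply/andP; split; lra.
Qed.

(** Continuity of inversion, through
    [(f x)^-1 - L^-1 = - (f x)^-1 (f x - L) L^-1]; the same identity first bounds
    [(f x)^-1] when [f x] is close to [L]. *)
Lemma cvg_invmx n (f : T -> 'M[R[i]]_n) (L : 'M[R[i]]_n) :
  (\forall x \near F, f x \in unitmx) -> L \in unitmx ->
  f @ F --> L -> (fun x => invmx (f x)) @ F --> invmx L.
Proof.
move=> fU LU /cvg_mxP fL.
set K := mxl1 (invmx L).
have K0 : 0 <= K by apply: mxl1_ge0.
have E x : f x \in unitmx ->
    invmx (f x) - invmx L = - (invmx (f x) *m (f x - L) *m invmx L).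
  move=> xU; rewrite mulmxBr mulmxBl mulVmx // mul1mx -mulmxA mulmxV // mulmx1.
  by rewrite opprB.
apply: (cvg_mxl1_le (g := fun x => (2 * K * K) * mxl1 (f x - L))); last first.
  by rewrite -(mulr0 (2 * K * K)); apply: cvgM => //; apply: cvg_cst.
have small : \forall x \near F, mxl1 (f x - L) * K <= 1 / 2.
  have : (fun x => mxl1 (f x - L) * K) @ F --> (0 : R).
    by rewrite -(mul0r K); apply: cvgM => //; apply: cvg_cst.
  have h2 : 0 < 1 / 2 :> R by lra.
  move/cvgrPdist_le => /(_ _ h2).
  by apply: filterS => x; rewrite sub0r normrN; apply: le_trans; apply: ler_norm.
near=> x.
have xU : f x \in unitmx by near: x.
have sm : mxl1 (f x - L) * K <= 1 / 2 by near: x.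
have bd A B : mxl1 (invmx (f x) *m A *m B) <= mxl1 (invmx (f x)) * mxl1 A * mxl1 B.
  by apply: le_trans (mxl1M _ _) _; apply: ler_wpM2r (mxl1M _ _); apply: mxl1_ge0.
have N0 := mxl1_ge0 (invmx (f x)).
have le1 : mxl1 (invmx (f x) - invmx L) <= mxl1 (invmx (f x)) * (mxl1 (f x - L) * K).
  by rewrite E // mxl1N mulrA; apply: bd.
have le2 : mxl1 (invmx (f x)) <= 2 * K.
  have : mxl1 (invmx (f x)) <= mxl1 (invmx (f x) - invmx L) + K.
    by rewrite -{1}(subrK (invmx L) (invmx (f x))); apply: mxl1D.
  have := ler_wpM2l N0 sm; lra.
apply: le_trans le1 _; rewrite -mulrA [K * mxl1 _]mulrC.
by apply: ler_wpM2r => //; apply: mulr_ge0 => //; apply: mxl1_ge0.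
Unshelve. all: by end_near. Qed.

End MatrixLimits.

Lemma cvg_mx_unique (R : realType) (T : Type) (F : set_system T)
    (FF : ProperFilter F) m n (f : T -> 'M[R[i]]_(m, n)) (L M : 'M[R[i]]_(m, n)) :
  f @ F --> L -> f @ F --> M -> L = M.
Proof.
move=> /cvg_mxP fL /cvg_mxP fM; apply/eqP; rewrite -subr_eq0; apply/eqP.
apply: mxl1_eq0; rewrite -(addr0 0).
apply: (cvgr_to_ge (cvgD fL fM)); apply: nearW => x.
have -> : L - M = (L - f x) + (f x - M) by rewrite addrA subrK.
by apply: le_trans (mxl1D _ _) _; rewrite [mxl1 (L - _)]mxl1B.
Qed.

(** A vector in the kernel of [1 + E] satisfies [v = - v E], which forces
    [v = 0] as soon as [mxl1 E < 1]. *)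
Lemma unitmx_perturb (R : realType) n (E : 'M[R[i]]_n) :
  mxl1 E < 1 -> 1%:M + E \in unitmx.
Proof.
move=> E1; rewrite -row_free_unit; apply: inj_row_free => v.
rewrite mulmxDr mulmx1 => /eqP; rewrite addr_eq0 => /eqP vE.
apply: mxl1_eq0; have : mxl1 v <= mxl1 v * mxl1 E by rewrite {1}vE mxl1N mxl1M.
have := mxl1_ge0 v; nra.
Qed.

(** * Derivatives along a set and the mean value inequality *)

Lemma cvg_near_eq (T : Type) (U : topologicalType) (F : set_system T)
    {FF : Filter F} (f g : T -> U) (l : U) :
  (\forall x \near F, f x = g x) -> f @ F --> l -> g @ F --> l.
Proof. by move=> fg fl A /fl; apply: filterS2 fg => x; rewrite /= => ->. Qed.

Section Derivative.
Variable R : realType.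
Implicit Types (E : set R) (x y : R) (m n : nat).

(** [is_dx] and [is_dt] are, by conversion, derivatives of this kind along the
    horizontal and vertical slices of the domain. *)
Definition der E m n (f : R -> 'M[R[i]]_(m, n)) x (l : 'M[R[i]]_(m, n)) : Prop :=
  ((y - x)%:C)^-1 *: (f y - f x) @[y --> within E x^'] --> l.

Lemma within_neq E x : \forall y \near within E x^', y != x.
Proof. by apply: (@cvg_within _ x^' _ E); exact: withinT. Qed.

Lemma within_dist E x (e : R) : 0 < e -> \forall y \near within E x^', `|y - x| < e.
Proof.
move=> e0; apply: (@cvg_within _ x^' _ E); apply: nbhs_dnbhs.
by apply: filterS (nbhsx_ballx x e e0) => y; rewrite /ball /= distrC.
Qed.

Lemma quotK m n (A : 'M[R[i]]_(m, n)) x y :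
  y != x -> (y - x)%:C *: (((y - x)%:C)^-1 *: A) = A.
Proof.
move=> yx; rewrite scalerA mulfV ?scale1r //.
by apply/eqP => /(@complexI R) /eqP; rewrite subr_eq0 (negPf yx).
Qed.

Lemma der_cvg E m n (f : R -> 'M[R[i]]_(m, n)) x l :
  der E f x l -> f y @[y --> within E x^'] --> f x.
Proof.
move=> df; apply: (cvg_mxl1_le (g := fun y => `|y - x| * (mxl1 l + 1))); last first.
  rewrite -(mul0r (mxl1 l + 1)); apply: cvgM; last exact: cvg_cst.
  apply/cvgrPdist_lt => e e0.
  by apply: filterS (within_dist E x e0) => y; rewrite sub0r normrN normr_id.
apply: filterS2 (within_neq E x) (cvg_mx_bounded df) => y yx bd.
by rewrite -[f y - f x](quotK _ yx) mxl1Z ler_wpM2l.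
Qed.

Lemma der_cvg_nbhs E m n (f : R -> 'M[R[i]]_(m, n)) x l :
  der E f x l -> f y @[y --> within E (nbhs x)] --> f x.
Proof.
move=> /der_cvg h A nA.
have {}h : nbhs x (fun y => y != x -> E y -> A (f y)) by exact: h A nA.
suff : nbhs x (fun y => E y -> A (f y)) by [].
apply: filterS h => y hy Ey; have [->|yx] := eqVneq y x; last exact: hy.
exact: nbhs_singleton.
Qed.

Lemma der_subset E E' m n (f : R -> 'M[R[i]]_(m, n)) x l :
  E' `<=` E -> der E f x l -> der E' f x l.
Proof.
move=> EE dfE A nA; have h : nbhs x (fun y => y != x -> E y -> A _) := dfE A nA.
suff : nbhs x (fun y => y != x -> E' y -> A (((y - x)%:C)^-1 *: (f y - f x))) by [].
by apply: filterS h => y hy yx /EE; exact: hy.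
Qed.

Lemma der_cst E m n (A : 'M[R[i]]_(m, n)) x : der E (fun=> A) x 0.
Proof.
rewrite /der; under eq_fun do rewrite subrr scaler0; exact: cvg_cst.
Qed.

Lemma derD E m n (f g : R -> 'M[R[i]]_(m, n)) x l k :
  der E f x l -> der E g x k -> der E (fun y => f y + g y) x (l + k).
Proof.
move=> df dg; apply: cvg_near_eq (cvg_mxD df dg).
by apply: nearW => y; rewrite -scalerDr opprD addrACA.
Qed.

Lemma derN E m n (f : R -> 'M[R[i]]_(m, n)) x l :
  der E f x l -> der E (fun y => - f y) x (- l).
Proof.
move=> df; apply: cvg_near_eq (cvg_mxN df).
by apply: nearW => y; rewrite -scalerN opprD.
Qed.

Lemma derM E m n p (f : R -> 'M[R[i]]_(m, n)) (g : R -> 'M[R[i]]_(n, p)) x l k :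
  der E f x l -> der E g x k ->
  der E (fun y => f y *m g y) x (l *m g x + f x *m k).
Proof.
move=> df dg.
have cf : (fun=> f x) @ within E x^' --> f x by exact: cvg_cst.
apply: (cvg_near_eq _ (cvg_mxD (cvg_mxM df (der_cvg dg)) (cvg_mxM cf dg))).
apply: nearW => y /=.
rewrite -scalemxAl -scalemxAr -scalerDr mulmxBl mulmxBr; congr (_ *: _).
by rewrite addrA subrK.
Qed.

(** Comes from [T y - T x = - T y (f y - f x) T x] for [T = f^-1]. *)
Lemma derV E n (f : R -> 'M[R[i]]_n) x l :
  (forall y, E y -> f y \in unitmx) -> f x \in unitmx ->
  der E f x l -> der E (fun y => invmx (f y)) x (- (invmx (f x) *m l *m invmx (f x))).
Proof.
move=> fU xU df.
have fU' : \forall y \near within E x^', f y \in unitmx.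
  by apply: filterS (withinT _ _) => y; exact: fU.
have cT : (fun=> invmx (f x)) @ within E x^' --> invmx (f x) by exact: cvg_cst.
apply: (cvg_near_eq _ (cvg_mxN (cvg_mxM (cvg_mxM (cvg_invmx fU' xU (der_cvg df)) df) cT))).
apply: filterS fU' => y yU /=.
rewrite -scalemxAr -scalemxAl -scalerN; congr (_ *: _).
by rewrite mulmxBr mulmxBl mulVmx // mul1mx -mulmxA mulmxV // mulmx1 opprB.
Qed.

Section SignFunctional.
Variables (m n : nat) (V : 'M[R[i]]_(m, n)).

(** A real-linear functional of norm one which attains its norm at [V]: it
    reduces the mean value inequality to the real mean value theorem. *)
Definition signf (A : 'M[R[i]]_(m, n)) : R :=
  \sum_i \sum_j (Num.sg (complex.Re (V i j)) * complex.Re (A i j)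
                 + Num.sg (complex.Im (V i j)) * complex.Im (A i j)).

Lemma signfV : signf V = mxl1 V.
Proof.
apply: eq_bigr => i _; apply: eq_bigr => j _.
by rewrite /cl1 !normrEsg.
Qed.

Lemma signfB A B : signf (A - B) = signf A - signf B.
Proof.
rewrite /signf -sumrB; apply: eq_bigr => i _; rewrite -sumrB.
by apply: eq_bigr => j _; rewrite !mxE; case: (A i j) (B i j) => ? ? [? ?] /=; ring.
Qed.

Lemma signfZ (c : R) A : signf (c%:C *: A) = c * signf A.
Proof.
rewrite /signf mulr_sumr; apply: eq_bigr => i _; rewrite mulr_sumr.
by apply: eq_bigr => j _; rewrite !mxE; case: (A i j) => ? ? /=; ring.
Qed.

Lemma signf_le A : `|signf A| <= mxl1 A.
Proof.
apply: le_trans (ler_norm_sum _ _ _) _; apply: ler_sum => i _.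
apply: le_trans (ler_norm_sum _ _ _) _; apply: ler_sum => j _.
apply: le_trans (ler_normD _ _) _; rewrite !normrM.
by apply: lerD; apply: ler_piMl => //; rewrite normr_sg; case: (_ != 0).
Qed.

Lemma signf_cvg T (F : set_system T) (FF : Filter F) (f : T -> 'M[R[i]]_(m, n))
    (L : 'M[R[i]]_(m, n)) :
  f @ F --> L -> (fun u => signf (f u)) @ F --> signf L.
Proof.
move=> /cvg_mxP fL; apply/cvgrPdist_lt => e e0.
apply: filterS (cvgr_lt _ fL _ e0) => u; apply: le_lt_trans.
by rewrite -signfB mxl1B signf_le.
Qed.

(** On the interior of [E] the derivative along [E] is the ordinary one. *)
Lemma signf_is_derive E (f : R -> 'M[R[i]]_(m, n)) (x : R) l :
  (\forall y \near x, E y) -> der E f x l -> is_derive x 1 (signf \o f) (signf l).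
Proof.
move=> Ex /cvg_mxP df.
have h : (fun h : R => h^-1 *: ((signf \o f \o shift x) (h *: 1) - signf (f x)))
    @ 0^' --> signf l.
  apply/cvgrPdist_lt => e e0.
  move/cvgrPdist_lt: df => /(_ _ e0) [d /= d0 hd].
  have [d' /= d'0 hd'] := Ex.
  exists (Num.min d d') => /=; first by rewrite lt_min d0.
  move=> h /=; rewrite sub0r normrN lt_min => /andP[hd1 hd2] h0.
  have hh : h + x - x = h by rewrite addrK.
  have := hd (h + x); rewrite /= /ball_ hh opprD addrCA subrr addr0 normrN.
  move=> /(_ hd1); have -> : (h + x != x) by rewrite -subr_eq0 hh.
  move=> /(_ isT) H.
  have {H} := H (hd' (h + x) _); rewrite /= /ball_ opprD addrCA subrr addr0 normrN.
  move=> /(_ hd2); rewrite sub0r normrN ger0_norm ?mxl1_ge0 //.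
  apply: le_lt_trans; rewrite /= scaler1.
  rewrite -normrN opprB -signfB; set Q := f _ - f x.
  have -> : h^-1 *: signf Q = signf (h%:C^-1 *: Q).
    rewrite (_ : h%:C^-1 = (h^-1)%:C); last by rewrite fmorphV.
    by rewrite signfZ.
  by rewrite -signfB signf_le.
constructor; first by apply: cvgP h.
by apply: cvg_lim h.
Qed.

End SignFunctional.

(** The real mean value theorem for the functional [signf] attached to
    [f b - f a], which loses no constant. At [a] and [b], where the derivative
    may be one-sided, it only serves to give continuity. *)
Lemma mean_value_ineq E m n (f d : R -> 'M[R[i]]_(m, n)) (a b M : R) :
  a <= b -> (forall x, a <= x <= b -> E x) ->
  (forall x, a <= x <= b -> der E f x (d x)) ->
  (forall x, a <= x <= b -> mxl1 (d x) <= M) ->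
  mxl1 (f b - f a) <= M * (b - a).
Proof.
move=> ab Eab df dM; set V := f b - f a.
have inE x : x \in `]a, b[%R -> a <= x <= b.
  by rewrite in_itv /= => /andP[/ltW-> /ltW->].
have [||c cab] := @MVT_segment R (signf V \o f) (signf V \o d) a b ab.
- move=> x xab; apply: (@signf_is_derive m n V E f x (d x)); last exact: df (inE x xab).
  have : nbhs x (`]a, b[%classic) by apply: near_in_itvoo.
  by apply: filterS => y /inE; exact: Eab.
- apply/subspace_continuousP => x /=; rewrite in_itv /= => xab.
  apply: signf_cvg; apply: der_cvg_nbhs (der_subset _ (df x xab)) => y.
  by rewrite /= in_itv; apply: Eab.
rewrite /= -signfB -/V signfV => ->.
apply: ler_wpM2r; first by rewrite subr_ge0.
apply: le_trans (ler_norm _) _; apply: le_trans (signf_le _ _) _.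
by apply: dM; move: cab; rewrite in_itv.
Qed.

End Derivative.

(** * Joint continuity on a rectangle *)

Lemma mean_value_ineq_sym (R : realType) (E : set R) m n
    (f d : R -> 'M[R[i]]_(m, n)) (lo hi M a b : R) :
  (forall x, lo <= x <= hi -> [/\ E x, der E f x (d x) & mxl1 (d x) <= M]) ->
  lo <= a <= hi -> lo <= b <= hi -> mxl1 (f b - f a) <= M * `|b - a|.
Proof.
move=> H; wlog ab : a b / a <= b => [hw|] aI bI.
  have [ab|/ltW ba] := leP a b; first exact: hw.
  by rewrite mxl1B distrC; apply: hw.
have sub x : a <= x <= b -> lo <= x <= hi by lra.
rewrite ger0_norm ?subr_ge0 //.
by apply: (@mean_value_ineq R E m n f d) => // x /sub/H [].
Qed.

Lemma der_scale (R : realType) (E : set R) m n (A : 'M[R[i]]_(m, n)) (a x : R) :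
  der E (fun y => (y - a)%:C *: A) x A.
Proof.
rewrite /der; apply: (cvg_near_eq _ (cvg_cst A)).
apply: filterS (within_neq E x) => y yx.
rewrite -scalerBl -rmorphB /= opprB addrA subrK -[A in LHS](quotK A yx).
by rewrite scalerA mulrC -scalerA.
Qed.

Lemma near_boxP (R : realType) (D : set (R * R)) (p : R * R) (P : set (R * R)) :
  (\forall q \near within D (nbhs p), P q) <->
  exists2 e : R, 0 < e &
    forall x t, `|x - p.1| < e -> `|t - p.2| < e -> D (x, t) -> P (x, t).
Proof.
split.
- move=> h; have {h} : nbhs p (fun q => D q -> P q) by exact: h.
  move/nbhs_ballP => [e /= e0 he]; exists e => // x t xe te.
  by apply: he; split; rewrite /ball /= distrC.
- move=> [e e0 he]; suff : nbhs p (fun q => D q -> P q) by [].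
  apply/nbhs_ballP; exists e => //= -[x t] [/= h1 h2]; apply: he.
    by rewrite distrC.
  by rewrite distrC.
Qed.

Section Rectangle.
Variables (R : realType) (b1 b2 : \bar R).
Let D := domain b1 b2.
Implicit Types (x t : R) (p q : R * R).

Lemma domain_mix x t x' t' : D (x, t) -> D (x', t') -> D (x, t').
Proof. by move=> [/= ? _] [/= _ ?]; split. Qed.

Lemma domain_convex_x x x' y t : D (x, t) -> D (x', t) -> x <= y <= x' -> D (y, t).
Proof.
move=> [/= [x0 _] ht] [/= [_ xb] _] /andP[xy yx]; split=> //=; split.
  exact: le_trans xy.
by apply: le_lt_trans xb; rewrite lee_fin.
Qed.

Lemma domain_convex_t x t t' y : D (x, t) -> D (x, t') -> t <= y <= t' -> D (x, y).
Proof.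
move=> [/= hx [t0 _]] [/= _ [_ tb]] /andP[ty yt]; split=> //=; split.
  exact: le_trans ty.
by apply: le_lt_trans tb; rewrite lee_fin.
Qed.

Lemma ico_room (b : \bar R) x e : 0 < e -> (x%:E < b)%E ->
  exists2 y, x < y < x + e & (y%:E < b)%E.
Proof.
move=> e0; case: b => [b||] //; rewrite ?lte_fin => xb.
- exists ((x + Num.min (x + e) b) / 2).
    have : x < Num.min (x + e) b by rewrite lt_min xb andbT; lra.
    have : Num.min (x + e) b <= x + e by rewrite ge_min lexx.
    by lra.
  rewrite lte_fin; have : Num.min (x + e) b <= b by rewrite ge_min lexx orbT.
  lra.
- by exists (x + e / 2); [lra | rewrite ltry].
Qed.

Lemma proper_dx p : D p -> ProperFilter (within [set y | D (y, p.2)] p.1^').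
Proof.
move=> [[x0 xb] ht]; apply: Build_ProperFilter_ex => A hA.
have {hA} : nbhs p.1 (fun y => y != p.1 -> D (y, p.2) -> A y) by exact: hA.
move=> /nbhs_ballP [e /= e0 he].
have [y /andP[y1 y2] yb] := ico_room e0 xb.
exists y; apply: he; last 1 first.
- by split => //=; split => //; apply: le_trans x0 (ltW y1).
- by rewrite /ball /= distrC ger0_norm; lra.
- by rewrite gt_eqF.
Qed.

Lemma proper_dt p : D p -> ProperFilter (within [set y | D (p.1, y)] p.2^').
Proof.
move=> [ht [x0 xb]]; apply: Build_ProperFilter_ex => A hA.
have {hA} : nbhs p.2 (fun y => y != p.2 -> D (p.1, y) -> A y) by exact: hA.
move=> /nbhs_ballP [e /= e0 he].
have [y /andP[y1 y2] yb] := ico_room e0 xb.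
exists y; apply: he; last 1 first.
- by split => //=; split => //; apply: le_trans x0 (ltW y1).
- by rewrite /ball /= distrC ger0_norm; lra.
- by rewrite gt_eqF.
Qed.

Lemma cvg_slice_t p (T : topologicalType) (g : R -> T) (l : T) : D p ->
  g y @[y --> within [set y | D (p.1, y)] (nbhs p.2)] --> l ->
  (fun q => g q.2) @ within D (nbhs p) --> l.
Proof.
move=> Dp gl A /gl hA.
have {hA} : nbhs p.2 (fun y => D (p.1, y) -> A (g y)) by exact: hA.
move=> /nbhs_ballP [e /= e0 he].
suff : \forall q \near within D (nbhs p), A (g q.2) by [].
apply/near_boxP; exists e => // x t _ te Dxt; apply: he.
  by rewrite /ball /= distrC.
by case: p Dp {gl e0 te} => x0 t0 /= Dp; apply: domain_mix Dp Dxt.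
Qed.

(** The linear growth bound on the x-derivative bounds [f] itself on short
    horizontal segments: if [N] is the maximum of the norm of [f] on a segment
    that starts at the abscissa of [p] and whose length [h] satisfies
    [K h <= 1 / 2], then [N <= mxl1 (f (p.1, t)) + (1 + N) / 2]. Hence [f] is
    Lipschitz in [x], uniformly in [t], near [p]. *)
Lemma joint_continuity m n (f phi : R * R -> 'M[R[i]]_(m, n)) p (K : R) :
  D p -> 0 <= K ->
  (forall q, D q -> is_dx D f q (phi q)) ->
  (\forall q \near within D (nbhs p), mxl1 (phi q) <= K * (1 + mxl1 (f q))) ->
  f (p.1, y) @[y --> within [set y | D (p.1, y)] (nbhs p.2)] --> f p ->
  f @ within D (nbhs p) --> f p.
Proof.
move=> Dp K0 fx /near_boxP [e e0 he] ft.
have ft' := cvg_slice_t Dp ft.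
apply: (cvg_mxl1_le (g := fun q => K * (2 + 2 * mxl1 (f (p.1, q.2))) * `|q.1 - p.1|
                              + mxl1 (f (p.1, q.2) - f p))); last first.
  rewrite -(addr0 0); apply: cvgD; last by apply/cvg_mxP; exact: ft'.
  rewrite -(mulr0 (K * (2 + 2 * mxl1 (f p)))); apply: cvgM.
    apply: cvgM; first exact: cvg_cst.
    apply: cvgD; first exact: cvg_cst.
    by apply: cvgM; [exact: cvg_cst | exact: cvg_mxl1 ft'].
  apply/cvgrPdist_lt => d d0; apply/near_boxP; exists d => // x t xd _ _.
  by rewrite /= sub0r normrN normr_id.
apply/near_boxP; exists (Num.min e (1 / (2 * (K + 1)))).
  by rewrite lt_min e0 divr_gt0 //; lra.
move=> x t; rewrite !lt_min => /andP[xe xK] /andP[te _] Dxt.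
case: p Dp ft ft' he xe xK te => x0 t0 /= Dp ft ft' he xe xK te.
apply: (le_trans (y := mxl1 (f (x, t) - f (x0, t)) + mxl1 (f (x0, t) - f (x0, t0)))).
  by rewrite -[X in mxl1 X](subrKA (f (x0, t))); apply: mxl1D.
rewrite lerD2r.
set lo := Num.min x0 x; set hi := Num.max x0 x.
have D0t : D (x0, t) by apply: domain_mix Dp Dxt.
have lohi : [/\ lo <= x0 <= hi, lo <= x <= hi & lo <= hi].
  by rewrite /lo /hi; case: (ltgtP x0 x); split; lra.
have [x0I xI lh] := lohi.
have inD y : lo <= y <= hi -> D (y, t) /\ `|y - x0| <= `|x - x0|.
  rewrite /lo /hi; case: (ltgtP x0 x) => xx yI.
  - split; first by apply: domain_convex_x yI.
    by rewrite !ger0_norm; lra.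
  - split; first by apply: domain_convex_x yI.
    by rewrite !ler0_norm; lra.
  - have -> : y = x0 by lra.
    by split => //; rewrite subrr normr0.
pose E := [set y | D (y, t)].
have cf : {within `[lo, hi], continuous (fun y => mxl1 (f (y, t)))}.
  apply/subspace_continuousP => y /=; rewrite in_itv /= => yI.
  apply: cvg_mxl1; apply: (@der_cvg_nbhs _ _ _ _ (fun y => f (y, t)) y (phi (y, t))).
  have [Dy _] := inD y yI.
  apply: (@der_subset _ E); last exact: fx Dy.
  by move=> z /=; rewrite in_itv => /inD [].
have [c] := EVT_max lh cf; rewrite in_itv => /= cI cmax.
set N := mxl1 (f (c, t)) in cmax.
have lip y : lo <= y <= hi -> mxl1 (f (y, t) - f (x0, t)) <= K * (1 + N) * `|y - x0|.
  move=> yI; apply: (@mean_value_ineq_sym _ E _ _ (fun y => f (y, t))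
    (fun y => phi (y, t)) lo hi _ _ _ _ x0I yI) => z zI.
  have [Dz zx] := inD z zI; split; [exact: Dz | exact: fx Dz |].
  apply: le_trans (he z t _ te Dz) _; first exact: le_lt_trans xe.
  by apply: ler_wpM2l => //; rewrite lerD2l; apply: cmax; rewrite in_itv.
have N0 : 0 <= N by apply: mxl1_ge0.
have KxN : K * `|x - x0| <= 1 / 2.
  have : `|x - x0| * (2 * (K + 1)) < 1 by rewrite -ltr_pdivlMr //; lra.
  have := normr_ge0 (x - x0); nra.
have Nle : 1 + N <= 2 + 2 * mxl1 (f (x0, t)).
  have : N <= mxl1 (f (c, t) - f (x0, t)) + mxl1 (f (x0, t)).
    by have := mxl1D (f (c, t) - f (x0, t)) (f (x0, t)); rewrite subrK.
  have := lip c cI; have [_ cx] := inD c cI.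
  have : K * (1 + N) * `|c - x0| <= (1 + N) * (1 / 2).
    rewrite mulrAC mulrC; apply: ler_wpM2l; first lra.
    by apply: le_trans KxN; apply: ler_wpM2l.
  lra.
apply: le_trans (lip x xI) _; apply: ler_wpM2r => //.
exact: ler_wpM2l.
Qed.

End Rectangle.

(** * Vanishing and mixed partial derivatives *)

Section PartialDerivativeTheory.
Variables (R : realType) (b1 b2 : \bar R).
Let D := domain b1 b2.
Implicit Types (x t : R) (p q : R * R).

Lemma eq_of_zero_partials m n (f : R * R -> 'M[R[i]]_(m, n)) :
  D (0, 0) ->
  (forall p, D p -> is_dx D f p 0) -> (forall p, D p -> is_dt D f p 0) ->
  forall p, D p -> f p = f (0, 0).
Proof.
move=> D0 fx ft [x t] Dp.
have [[/= x0 _] [/= t0 _]] := Dp.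
have D0t : D (0, t) by apply: domain_mix D0 Dp.
have step1 : f (x, t) = f (0, t).
  apply/eqP; rewrite -subr_eq0; apply/eqP/mxl1_eq0.
  have := @mean_value_ineq_sym R [set y | D (y, t)] _ _ (fun y => f (y, t))
            (fun=> 0) 0 x 0 0 x.
  rewrite mul0r; apply; rewrite ?lexx ?x0 // => y yI.
  have Dy : D (y, t) by apply: domain_convex_x yI.
  by split; [exact: Dy | exact: fx Dy | rewrite mxl10].
rewrite step1; apply/eqP; rewrite -subr_eq0; apply/eqP/mxl1_eq0.
have := @mean_value_ineq_sym R [set y | D (0, y)] _ _ (fun y => f (0, y))
          (fun=> 0) 0 t 0 0 t.
rewrite mul0r; apply; rewrite ?lexx ?t0 // => y yI.
have Dy : D (0, y) by apply: domain_convex_t yI.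
by split; [exact: Dy | exact: ft Dy | rewrite mxl10].
Qed.

Lemma mxl1_le_eq m n (A B : 'M[R[i]]_(m, n)) (M : R) : A = B -> mxl1 A <= M -> mxl1 B <= M.
Proof. by move=> ->. Qed.

Lemma mxl1Zinv m n (A : 'M[R[i]]_(m, n)) x t :
  mxl1 ((x - t)%:C^-1 *: A) = mxl1 A / `|x - t|.
Proof.
rewrite (_ : (x - t)%:C^-1 = ((x - t)^-1)%:C); last by rewrite fmorphV.
by rewrite mxl1Z normfV mulrC.
Qed.

(** Symmetry of mixed derivatives, when only one of them is known to be
    continuous and only at [p]. Two applications of the mean value inequality
    compare the second difference of [f] over a small rectangle at [p] with the
    increment of [psi p]; letting the height and then the width of the rectangle
    go to [0] gives the claim. *)
Lemma mixed_partials m n (f phi chi psi : R * R -> 'M[R[i]]_(m, n)) p c :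
  D p ->
  (\forall q \near within D (nbhs p),
    [/\ is_dx D f q (phi q), is_dt D f q (chi q) & is_dt D phi q (psi q)]) ->
  psi @ within D (nbhs p) --> psi p -> is_dx D chi p c ->
  c = psi p.
Proof.
case: p => x0 t0 Dp hloc /cvg_mxP psic chix.
have [e1 /= e10 he1] := (near_boxP _ _ _).1 hloc.
apply/eqP; rewrite -subr_eq0; apply/eqP/mxl1_eq0/ler_addgt0Pr => d d0; rewrite add0r.
have [e2 /= e20 he2] := (near_boxP _ _ _).1 (cvgr_lt _ psic _ d0).
pose e := Num.min e1 e2.
have e0 : 0 < e by rewrite lt_min e10.
have {}he1 x t : `|x - x0| < e -> `|t - t0| < e -> D (x, t) ->
    [/\ der [set y | D (y, t)] (fun y => f (y, t)) x (phi (x, t)),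
        der [set y | D (x, y)] (fun y => f (x, y)) t (chi (x, t))
      & der [set y | D (x, y)] (fun y => phi (x, y)) t (psi (x, t))].
  by rewrite !lt_min => /andP[? _] /andP[? _]; exact: he1.
have {}he2 x t : `|x - x0| < e -> `|t - t0| < e -> D (x, t) ->
    mxl1 (psi (x, t) - psi (x0, t0)) <= d.
  by rewrite !lt_min => /andP[_ ?] /andP[_ ?] ?; apply: ltW; apply: he2.
set P0 := psi (x0, t0) in he2 *.
(* both mean value steps stay in the rectangle spanned by (x0, t0) and (x, t) *)
have minmax (u v y : R) : Num.min u v <= y <= Num.max u v -> `|v - u| < e -> `|y - u| < e.
  case: (ltgtP u v) => uv yI; first by rewrite !ger0_norm; lra.
    by rewrite !ler0_norm; lra.
  have -> : y = u by lra.
  by rewrite subrr normr0.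
have minmaxl (u v : R) : Num.min u v <= u <= Num.max u v by case: (ltgtP u v); lra.
have minmaxr (u v : R) : Num.min u v <= v <= Num.max u v by case: (ltgtP u v); lra.
have rectx x t y : D (x, t) -> Num.min x0 x <= y <= Num.max x0 x -> D (y, t).
  move=> Dxt; have D0 : D (x0, t) by apply: domain_mix Dp Dxt.
  case: (ltgtP x0 x) => e0x yI; first exact: domain_convex_x D0 Dxt yI.
    exact: domain_convex_x Dxt D0 yI.
  by apply: domain_convex_x D0 _ yI; rewrite ?e0x // -e0x.
have rectt x t y : D (x, t) -> Num.min t0 t <= y <= Num.max t0 t -> D (x, y).
  move=> Dxt; have D0 : D (x, t0) by apply: domain_mix Dxt Dp.
  case: (ltgtP t0 t) => e0x yI; first exact: domain_convex_t D0 Dxt yI.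
    exact: domain_convex_t Dxt D0 yI.
  by apply: domain_convex_t D0 _ yI; rewrite ?e0x // -e0x.
have step1 x t : `|x - x0| < e -> `|t - t0| < e -> D (x, t) ->
    mxl1 (phi (x, t) - phi (x, t0) - (t - t0)%:C *: P0) <= d * `|t - t0|.
  move=> xe te Dxt.
  apply: (mxl1_le_eq (A := (phi (x, t) - (t - t0)%:C *: P0)
                        - (phi (x, t0) - (t0 - t0)%:C *: P0))); first by mx_lin.
  apply: (@mean_value_ineq_sym R [set y | D (x, y)] _ _
    (fun y => phi (x, y) - (y - t0)%:C *: P0) (fun y => psi (x, y) - P0)
    _ _ d t0 t _ (minmaxl _ _) (minmaxr _ _)) => y yI.
  have Dy := rectt _ _ _ Dxt yI; have ye := minmax _ _ _ yI te.
  split; [exact: Dy | | exact: he2].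
  have [_ _ dphi] := he1 _ _ xe ye Dy.
  exact: (derD dphi (derN (der_scale _ t0 y))).
have step2 x t : `|x - x0| < e -> `|t - t0| < e -> D (x, t) ->
    mxl1 ((f (x, t) - f (x, t0)) - (f (x0, t) - f (x0, t0))
        - (x - x0)%:C *: ((t - t0)%:C *: P0)) <= d * `|t - t0| * `|x - x0|.
  move=> xe te Dxt.
  have Dx0 : D (x, t0) by apply: domain_mix Dxt Dp.
  apply: (mxl1_le_eq
    (A := (f (x, t) - f (x, t0) - (x - x0)%:C *: ((t - t0)%:C *: P0))
        - (f (x0, t) - f (x0, t0) - (x0 - x0)%:C *: ((t - t0)%:C *: P0)))).
    by mx_lin.
  apply: (@mean_value_ineq_sym R [set y | D (y, t)] _ _
    (fun y => f (y, t) - f (y, t0) - (y - x0)%:C *: ((t - t0)%:C *: P0))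
    (fun y => phi (y, t) - phi (y, t0) - (t - t0)%:C *: P0)
    _ _ (d * `|t - t0|) x0 x _ (minmaxl _ _) (minmaxr _ _)) => y yI.
  have Dy := rectx _ _ _ Dxt yI; have ye := minmax _ _ _ yI xe.
  have Dy0 := rectx _ _ _ Dx0 yI.
  split; [exact: Dy | | exact: step1].
  have [dphi _ _] := he1 _ _ ye te Dy.
  have t0e : `|t0 - t0| < e by rewrite subrr normr0.
  have [dphi0 _ _] := he1 _ _ ye t0e Dy0.
  apply: (derD (derD dphi _) (derN (der_scale _ x0 y))); apply: derN.
  apply: (der_subset _ dphi0) => z /= Dz; exact: domain_mix Dz Dp.
have step3 x : `|x - x0| < e -> D (x, t0) ->
    mxl1 (chi (x, t0) - chi (x0, t0) - (x - x0)%:C *: P0) <= d * `|x - x0|.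
  move=> xe Dx.
  have t0e : `|t0 - t0| < e by rewrite subrr normr0.
  have x0e : `|x0 - x0| < e by rewrite subrr normr0.
  have [_ dchi _] := he1 _ _ xe t0e Dx.
  have [_ dchi0 _] := he1 _ _ x0e t0e Dp.
  pose E := [set y | D (x0, y)].
  have PF : ProperFilter (within E t0^') by apply: (proper_dt Dp).
  have dchi' : der E (fun y => f (x, y)) t0 (chi (x, t0)).
    by apply: (der_subset _ dchi) => z /= Dz; apply: domain_mix Dx Dz.
  apply: (cvgr_to_le (cvg_mxl1 (derD (derD dchi' (derN dchi0)) (derN (@der_scale _ E _ _ ((x - x0)%:C *: P0) t0 t0))))); near=> y.
  have yt : y != t0 by near: y; exact: within_neq.
  have Ey : E y by near: y; exact: withinT.
  have ye : `|y - t0| < e by near: y; exact: within_dist.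
  have y0 : 0 < `|y - t0| by rewrite normr_gt0 subr_eq0.
  rewrite mxl1Zinv // ler_pdivrMr // mulrAC.
  apply: (mxl1_le_eq _ (step2 x y xe ye _)); first by mx_lin.
  exact: domain_mix Dx Ey.
have PF : ProperFilter (within [set y | D (y, t0)] x0^') by apply: (proper_dx Dp).
have chix' : der [set y | D (y, t0)] (fun y => chi (y, t0)) x0 c by exact: chix.
apply: (cvgr_to_le (cvg_mxl1 (derD chix' (derN (@der_scale _ [set y | D (y, t0)] _ _ P0 x0 x0))))); near=> y.
have yt : y != x0 by near: y; exact: within_neq.
have Ey : D (y, t0) by near: y; exact: withinT.
have ye : `|y - x0| < e by near: y; exact: within_dist.
have y0 : 0 < `|y - x0| by rewrite normr_gt0 subr_eq0.
rewrite mxl1Zinv // ler_pdivrMr //; apply: (mxl1_le_eq _ (step3 y ye Ey)).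
by mx_lin.
Unshelve. all: by end_near. Qed.

End PartialDerivativeTheory.

(** * Regularity classes of matrix functions *)

Section RelativelyOpen.
Variables (R : realType) (D U : set (R * R)).
Hypothesis UD : U `<=` D.
Hypothesis Uopen : forall p, U p -> \forall q \near within D (nbhs p), U q.

(** Limits inside [U] and inside [D] agree at the points of [U], so partial
    derivatives and continuity can be moved between [U] and [D]. *)
Lemma within_openE p : U p -> within U (nbhs p) = within D (nbhs p).
Proof.
move=> Up; apply/funext => A; apply/propext.
have h : nbhs p (fun q => D q -> U q) := Uopen Up.
split=> hA; last by apply: filterS (hA : nbhs p _) => q hq /UD; exact: hq.
suff : nbhs p (fun q => D q -> A q) by [].
by apply: filterS2 h (hA : nbhs p _) => q DU UA /DU; exact: UA.
Qed.

Lemma within_open_x p : U p ->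
  within [set y | U (y, p.2)] p.1^' = within [set y | D (y, p.2)] p.1^'.
Proof.
case: p => x t /= Up; apply/funext => A; apply/propext.
have [e e0 he] := (near_boxP _ _ _).1 (Uopen Up).
split=> hA.
- have {}hA : nbhs x (fun y => y != x -> U (y, t) -> A y) by exact: hA.
  suff : nbhs x (fun y => y != x -> D (y, t) -> A y) by [].
  apply: filterS2 hA (nbhsx_ballx x e e0) => y hy xy yx Dy.
  by apply: hy => //; apply: he; rewrite //= ?subrr ?normr0 // distrC.
- have {}hA : nbhs x (fun y => y != x -> D (y, t) -> A y) by exact: hA.
  suff : nbhs x (fun y => y != x -> U (y, t) -> A y) by [].
  by apply: filterS hA => y hy yx /UD; exact: hy.
Qed.

Lemma within_open_t p : U p ->
  within [set y | U (p.1, y)] p.2^' = within [set y | D (p.1, y)] p.2^'.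
Proof.
case: p => x t /= Up; apply/funext => A; apply/propext.
have [e e0 he] := (near_boxP _ _ _).1 (Uopen Up).
split=> hA.
- have {}hA : nbhs t (fun y => y != t -> U (x, y) -> A y) by exact: hA.
  suff : nbhs t (fun y => y != t -> D (x, y) -> A y) by [].
  apply: filterS2 hA (nbhsx_ballx t e e0) => y hy xy yx Dy.
  by apply: hy => //; apply: he; rewrite //= ?subrr ?normr0 // distrC.
- have {}hA : nbhs t (fun y => y != t -> D (x, y) -> A y) by exact: hA.
  suff : nbhs t (fun y => y != t -> U (x, y) -> A y) by [].
  by apply: filterS hA => y hy yx /UD; exact: hy.
Qed.

Lemma is_dx_open m n (f : R * R -> 'M[R[i]]_(m, n)) p l :
  U p -> is_dx U f p l = is_dx D f p l.
Proof. by move=> Up; rewrite /is_dx within_open_x. Qed.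

Lemma is_dt_open m n (f : R * R -> 'M[R[i]]_(m, n)) p l :
  U p -> is_dt U f p l = is_dt D f p l.
Proof. by move=> Up; rewrite /is_dt within_open_t. Qed.

Lemma continuous_open m n (f : R * R -> 'M[R[i]]_(m, n)) :
  {within D, continuous f} -> {within U, continuous f}.
Proof.
move=> /subspace_continuousP cf; apply/subspace_continuousP => p Up.
by rewrite within_openE //; apply: cf; exact: UD.
Qed.

End RelativelyOpen.

Section PartialDerivativeRules.
Variables (R : realType) (U : set (R * R)).
Implicit Types (p : R * R).

Lemma is_dx_cst m n (A : 'M[R[i]]_(m, n)) p : is_dx U (fun=> A) p 0.
Proof. exact: der_cst. Qed.

Lemma is_dt_cst m n (A : 'M[R[i]]_(m, n)) p : is_dt U (fun=> A) p 0.
Proof. exact: der_cst. Qed.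

Lemma is_dxD m n (f g : R * R -> 'M[R[i]]_(m, n)) p l k :
  is_dx U f p l -> is_dx U g p k -> is_dx U (fun q => f q + g q) p (l + k).
Proof.
by case: p => x t; exact: (@derD _ _ _ _ (fun y => f (y, t)) (fun y => g (y, t))).
Qed.

Lemma is_dtD m n (f g : R * R -> 'M[R[i]]_(m, n)) p l k :
  is_dt U f p l -> is_dt U g p k -> is_dt U (fun q => f q + g q) p (l + k).
Proof.
by case: p => x t; exact: (@derD _ _ _ _ (fun y => f (x, y)) (fun y => g (x, y))).
Qed.

Lemma is_dxN m n (f : R * R -> 'M[R[i]]_(m, n)) p l :
  is_dx U f p l -> is_dx U (fun q => - f q) p (- l).
Proof. by case: p => x t; exact: (@derN _ _ _ _ (fun y => f (y, t))). Qed.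

Lemma is_dtN m n (f : R * R -> 'M[R[i]]_(m, n)) p l :
  is_dt U f p l -> is_dt U (fun q => - f q) p (- l).
Proof. by case: p => x t; exact: (@derN _ _ _ _ (fun y => f (x, y))). Qed.

Lemma is_dxM m n k (f : R * R -> 'M[R[i]]_(m, n)) (g : R * R -> 'M[R[i]]_(n, k))
    p df dg :
  is_dx U f p df -> is_dx U g p dg ->
  is_dx U (fun q => f q *m g q) p (df *m g p + f p *m dg).
Proof.
by case: p => x t; exact: (@derM _ _ _ _ _ (fun y => f (y, t)) (fun y => g (y, t))).
Qed.

Lemma is_dtM m n k (f : R * R -> 'M[R[i]]_(m, n)) (g : R * R -> 'M[R[i]]_(n, k))
    p df dg :
  is_dt U f p df -> is_dt U g p dg ->
  is_dt U (fun q => f q *m g q) p (df *m g p + f p *m dg).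
Proof.
by case: p => x t; exact: (@derM _ _ _ _ _ (fun y => f (x, y)) (fun y => g (x, y))).
Qed.

Lemma is_dxV n (f : R * R -> 'M[R[i]]_n) p l :
  (forall q, U q -> f q \in unitmx) -> U p -> is_dx U f p l ->
  is_dx U (fun q => invmx (f q)) p (- (invmx (f p) *m l *m invmx (f p))).
Proof.
case: p => x t fU Up; apply: (@derV _ _ _ (fun y => f (y, t))); last exact: fU.
by move=> y; exact: fU.
Qed.

Lemma is_dtV n (f : R * R -> 'M[R[i]]_n) p l :
  (forall q, U q -> f q \in unitmx) -> U p -> is_dt U f p l ->
  is_dt U (fun q => invmx (f q)) p (- (invmx (f p) *m l *m invmx (f p))).
Proof.
case: p => x t fU Up; apply: (@derV _ _ _ (fun y => f (x, y))); last exact: fU.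
by move=> y; exact: fU.
Qed.

End PartialDerivativeRules.

(** The three regularity properties at stake (continuity, continuity together
    with the t-derivative, differentiability in x) are all stable under the
    operations that build the transformed coefficients. *)
Record mxclass (R : realType)
    (Q : forall m n, (R * R -> 'M[R[i]]_(m, n)) -> Prop) : Prop := MxClass {
  mxclass_cst : forall m n (A : 'M[R[i]]_(m, n)), Q m n (fun=> A);
  mxclassD : forall m n (f g : R * R -> 'M[R[i]]_(m, n)),
    Q m n f -> Q m n g -> Q m n (fun p => f p + g p);
  mxclassN : forall m n (f : R * R -> 'M[R[i]]_(m, n)),
    Q m n f -> Q m n (fun p => - f p);
  mxclassM : forall m n k (f : R * R -> 'M[R[i]]_(m, n))
      (g : R * R -> 'M[R[i]]_(n, k)),
    Q m n f -> Q n k g -> Q m k (fun p => f p *m g p)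
}.

Section Classes.
Variables (R : realType) (U : set (R * R)).

Lemma continuous_class :
  mxclass (fun m n (f : R * R -> 'M[R[i]]_(m, n)) => {within U, continuous f}).
Proof.
split=> [m n A|m n f g|m n f|m n k f g].
- by apply/subspace_continuousP => p _; apply: cvg_cst.
- move=> /subspace_continuousP cf /subspace_continuousP cg.
  by apply/subspace_continuousP => p Up; apply: cvg_mxD; [apply: cf | apply: cg].
- move=> /subspace_continuousP cf.
  by apply/subspace_continuousP => p Up; apply: cvg_mxN; apply: cf.
- move=> /subspace_continuousP cf /subspace_continuousP cg.
  by apply/subspace_continuousP => p Up; apply: cvg_mxM; [apply: cf | apply: cg].
Qed.

Definition contC1_t m n (f : R * R -> 'M[R[i]]_(m, n)) : Prop :=
  {within U, continuous f} /\ C1_t U f.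

Lemma contC1_t_class : mxclass contC1_t.
Proof.
have C := continuous_class.
split=> [m n A|m n f g|m n f|m n k f g].
- split; first exact: (mxclass_cst C).
  exists (fun=> 0); split; last exact: (mxclass_cst C).
  by move=> p _; apply: is_dt_cst.
- move=> [cf [f' [df cf']]] [cg [g' [dg cg']]]; split; first exact: (mxclassD C).
  exists (fun p => f' p + g' p); split; last exact: (mxclassD C).
  by move=> p Up; apply: is_dtD; [apply: df | apply: dg].
- move=> [cf [f' [df cf']]]; split; first exact: (mxclassN C).
  exists (fun p => - f' p); split; last exact: (mxclassN C).
  by move=> p Up; apply: is_dtN; apply: df.
- move=> [cf [f' [df cf']]] [cg [g' [dg cg']]]; split; first exact: (mxclassM C).
  exists (fun p => f' p *m g p + f p *m g' p); split.
    by move=> p Up; apply: is_dtM; [apply: df | apply: dg].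
  by apply: (mxclassD C); apply: (mxclassM C).
Qed.

Lemma differentiable_x_class : mxclass (fun m n f => @differentiable_x R U m n f).
Proof.
split=> [m n A p _|m n f g hf hg p Up|m n f hf p Up|m n k f g hf hg p Up].
- by exists 0; apply: is_dx_cst.
- by have [l lf] := hf p Up; have [k kg] := hg p Up; exists (l + k); apply: is_dxD.
- by have [l lf] := hf p Up; exists (- l); apply: is_dxN.
- have [l lf] := hf p Up; have [k' kg] := hg p Up.
  by exists (l *m g p + f p *m k'); apply: is_dxM.
Qed.

End Classes.

Section ClassTheory.
Variables (R : realType) (Q : forall m n, (R * R -> 'M[R[i]]_(m, n)) -> Prop).
Hypothesis C : mxclass Q.

Lemma mxclassZ m n (c : R[i]) (f : R * R -> 'M[R[i]]_(m, n)) :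
  Q f -> Q (fun p => c *: f p).
Proof.
move=> Qf; have := mxclassM C (mxclass_cst C c%:M) Qf.
by congr Q; apply/funext => p; rewrite mul_scalar_mx.
Qed.

Lemma mxclass_sum m n (I : eqType) (r : seq I) (f : I -> R * R -> 'M[R[i]]_(m, n)) :
  (forall i, i \in r -> Q (f i)) -> Q (fun p => \sum_(i <- r) f i p).
Proof.
elim: r => [|a r IH] h.
  have := mxclass_cst C (0 : 'M[R[i]]_(m, n)).
  by congr Q; apply/funext => p; rewrite big_nil.
have := mxclassD C (h a (mem_head _ _)) (IH (fun i ir => h i (mem_behead (s := a :: r) ir))).
by congr Q; apply/funext => p; rewrite big_cons.
Qed.

Variables (m n : nat) (A1 A2 : 'M[R[i]]_n) (Pi1 Pi2 : R * R -> 'M[R[i]]_(n, m)).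
Variable S : R * R -> 'M[R[i]]_n.
Hypothesis QPi1 : Q Pi1.
Hypothesis QPi2 : Q (fun p => (Pi2 p) ^t*).

Lemma mxclass_rhs_Pi1 G : all_coefs (@Q m m) G -> Q (rhs_Pi1 A1 Pi1 G).
Proof.
move=> [Qc Qp]; rewrite /rhs_Pi1; apply: (mxclassD C); apply: mxclass_sum => k.
  rewrite mem_index_iota /= ltnS => kG.
  apply: (mxclassM C); last exact: Qc.
  by apply: (mxclassM C) => //; apply: (mxclass_cst C).
move=> _; apply: mxclass_sum => j; rewrite mem_index_iota /= ltnS => jG.
apply: (mxclassM C); last exact: Qp.
by apply: (mxclassM C) => //; apply: (mxclass_cst C).
Qed.

Lemma mxclass_rhs_Pi2 G : all_coefs (@Q m m) G -> Q (rhs_Pi2 A2 Pi2 G).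
Proof.
move=> [Qc Qp]; rewrite /rhs_Pi2; apply: (mxclassN C).
apply: (mxclassD C); apply: mxclass_sum => k.
  rewrite mem_index_iota /= ltnS => kG.
  apply: (mxclassM C); last exact: (mxclass_cst C).
  by apply: (mxclassM C) => //; apply: Qc.
move=> _; apply: mxclass_sum => j; rewrite mem_index_iota /= ltnS => jG.
apply: (mxclassM C); last exact: (mxclass_cst C).
by apply: (mxclassM C) => //; apply: Qp.
Qed.

Lemma mxclass_rhs_S G : all_coefs (@Q m m) G -> Q (rhs_S A1 A2 Pi1 Pi2 G).
Proof.
have Qterm (B1 B2 : 'M[R[i]]_n) f : Q f -> Q (fun p => B1 *m Pi1 p *m f p *m (Pi2 p)^t* *m B2).
  move=> Qf; apply: (mxclassM C); last exact: (mxclass_cst C).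
  apply: (mxclassM C) => //; apply: (mxclassM C) => //.
  by apply: (mxclassM C) => //; apply: (mxclass_cst C).
move=> [Qc Qp]; rewrite /rhs_S; apply: (mxclassD C); last apply: (mxclassN C).
  apply: mxclass_sum => k; rewrite mem_index_iota /= ltnS => /andP[_ kG].
  by apply: mxclass_sum => j _; apply: Qterm; apply: Qc.
apply: mxclass_sum => s _; apply: mxclass_sum => k.
rewrite mem_index_iota /= ltnS => kG.
by apply: mxclass_sum => j _; apply: Qterm; apply: Qp.
Qed.

Lemma mxclass_eval G z : all_coefs (@Q m m) G -> Q (ratmx_eval G z).
Proof.
move=> [Qc Qp]; rewrite /ratmx_eval; apply: (mxclassD C); apply: (mxclassN C).
  apply: mxclass_sum => k; rewrite mem_index_iota /= ltnS => kG.
  by apply: mxclassZ; apply: Qc.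
apply: mxclass_sum => s _; apply: mxclass_sum => k.
by rewrite mem_index_iota /= ltnS => kG; apply: mxclassZ; apply: Qp.
Qed.

Hypothesis QS : Q (fun p => invmx (S p)).

Lemma mxclass_transform G :
  all_coefs (@Q m m) G -> all_coefs (@Q m m) (transform A1 A2 Pi1 Pi2 S G).
Proof.
have QX (B : 'M[R[i]]_n) : Q (fun p => (Pi2 p)^t* *m invmx (S p) *m B *m Pi1 p).
  apply: (mxclassM C) => //; apply: (mxclassM C); last exact: (mxclass_cst C).
  exact: (mxclassM C).
have QY (B : 'M[R[i]]_n) : Q (fun p => (Pi2 p)^t* *m B *m invmx (S p) *m Pi1 p).
  apply: (mxclassM C) => //; apply: (mxclassM C) => //.
  by apply: (mxclassM C) => //; exact: (mxclass_cst C).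
move=> [Qc Qp]; split=> [k /= kG|s k /= /andP[k1 kG]].
- apply: (mxclassD C); first exact: Qc.
  apply/(mxclassN C)/mxclass_sum => j; rewrite mem_index_iota ltnS => /andP[_ jG].
  apply: (mxclassD C).
    apply: (mxclassD C); first by apply: (mxclassM C); [apply: Qc | apply: QY].
    by apply: (mxclassN C); apply: (mxclassM C); [apply: QX | apply: Qc].
  apply: mxclass_sum => i _; apply: (mxclassM C); last exact: QY.
  by apply: (mxclassM C); [apply: QX | apply: Qc].
- apply: (mxclassD C); first by apply: Qp; rewrite k1.
  apply: mxclass_sum => j; rewrite mem_index_iota ltnS => /andP[kj jG].
  have jG' : (0 < j <= mult s)%N by rewrite (leq_trans k1 kj).
  apply: (mxclassD C).
    apply: (mxclassD C); first by apply: (mxclassM C); [apply: Qp | apply: QY].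
    by apply: (mxclassN C); apply: (mxclassM C); [apply: QX | apply: Qp].
  apply/(mxclassN C)/mxclass_sum => i _; apply: (mxclassM C); last exact: QY.
  by apply: (mxclassM C); [apply: QX | apply: Qp].
Qed.

End ClassTheory.

(** * Divided differences of monomials *)

Section ScalarTerms.
Variables (K : fieldType) (n : nat).
Implicit Types (A B N : 'M[K]_n) (z c : K) (k j : nat).

Lemma mxpowS A k : A ^+ k.+1 = A *m A ^+ k.
Proof. by rewrite exprS mulmxE. Qed.

Lemma mxpowSr A k : A ^+ k.+1 = A ^+ k *m A.
Proof. by rewrite exprSr mulmxE. Qed.

Lemma mxexpz_opp A k : mxexpz A (- k%:Z) = invmx A ^+ k.
Proof. by case: k => [|k] //; rewrite oppr0 /= !expr0. Qed.

Lemma sub_shift_mx A z c : A - z%:M = (A - c%:M) - (z - c)%:M.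
Proof. by rewrite raddfB /= opprB addrA subrK. Qed.

Section Polynomial.
Variables (A1 A2 N : 'M[K]_n) (z : K) (j : nat).

Definition poly_dd : 'M[K]_n :=
  \sum_(1 <= i < j.+1) A1 ^+ (j - i) *m N *m A2 ^+ (i - 1).

Definition poly_quot A : 'M[K]_n := \sum_(0 <= k < j) z ^+ k *: A ^+ (j - k - 1).

Definition poly_dd2 : 'M[K]_n :=
  \sum_(0 <= k < j) z ^+ k *:
    \sum_(k.+2 <= i < j.+1) A1 ^+ (j - i) *m N *m A2 ^+ (i - k - 2).

Lemma poly_ddE : A1 *m poly_dd - poly_dd *m A2 = A1 ^+ j *m N - N *m A2 ^+ j.
Proof.
rewrite /poly_dd mulmx_sumr mulmx_suml -sumrB big_add1 /=.
rewrite (GRing.telescope_sumr_eq (fun i => - (A1 ^+ (j - i) *m N *m A2 ^+ i))) //.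
  by rewrite subnn subn0 !expr0 -/(1%:M) mul1mx mulmx1 opprK addrC.
move=> i /andP[_ ij]; rewrite opprK addrC subn1 /=.
rewrite !mulmxA -mxpowS -subSn // subSS.
by rewrite mxpowSr !mulmxA.
Qed.

Lemma poly_quotEl A : (A - z%:M) *m poly_quot A = A ^+ j - (z ^+ j)%:M.
Proof.
rewrite /poly_quot mulmx_sumr.
rewrite (GRing.telescope_sumr_eq (fun k => - (z ^+ k *: A ^+ (j - k)))) //.
  by rewrite subnn subn0 !expr0 -/(1%:M) scale1r scalemx1 opprK addrC.
move=> k /andP[_ kj]; rewrite opprK [RHS]addrC mulmxBl mul_scalar_mx -scalemxAr -mxpowS.
rewrite scalerA -exprS.
have -> : ((j - k - 1).+1 = j - k)%N by lia.
by rewrite -subnDA addn1.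
Qed.

Lemma poly_quotEr A : poly_quot A *m (A - z%:M) = A ^+ j - (z ^+ j)%:M.
Proof.
rewrite /poly_quot mulmx_suml.
rewrite (GRing.telescope_sumr_eq (fun k => - (z ^+ k *: A ^+ (j - k)))) //.
  by rewrite subnn subn0 !expr0 -/(1%:M) scale1r scalemx1 opprK addrC.
move=> k /andP[_ kj]; rewrite opprK [RHS]addrC mulmxBr mul_mx_scalar -scalemxAl -mxpowSr.
rewrite scalerA -exprS.
have -> : ((j - k - 1).+1 = j - k)%N by lia.
by rewrite -subnDA addn1.
Qed.

(** The inner sums [V k] of [poly_dd2] satisfy [V (k+1) A2 = V k - A1^(j-k-1) N],
    so the sum over [k] telescopes from [poly_dd = V 0] to [V j = 0]. *)
Lemma poly_dd2E : poly_dd2 *m (A2 - z%:M) = poly_dd - poly_quot A1 *m N.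
Proof.
pose V k := \sum_(k.+1 <= i < j.+1) A1 ^+ (j - i) *m N *m A2 ^+ (i - k.+1).
have VS k : (k < j)%N -> V k.+1 *m A2 = V k - A1 ^+ (j - k - 1) *m N.
  move=> kj; rewrite /V [X in _ = X - _]big_ltn ?ltnS // subnn expr0 -/(1%:M) mulmx1.
  rewrite -subnDA addn1 addrAC subrr add0r mulmx_suml.
  apply: eq_big_nat => i /andP[ki _]; rewrite -mulmxA -mxpowSr.
  by congr (_ *m _ ^+ _); lia.
have -> : poly_dd = V 0%N by apply: eq_bigr => i _.
have -> : poly_dd2 = \sum_(0 <= k < j) z ^+ k *: V k.+1.
  apply: eq_bigr => k _; congr (_ *: _); apply: eq_bigr => i _.
  by congr (_ *m _ ^+ _); lia.
rewrite mulmx_suml mulmx_suml.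
apply/eqP; rewrite eq_sym subr_eq -big_split /=; apply/eqP.
rewrite (GRing.telescope_sumr_eq (fun k => - (z ^+ k *: V k))) //.
  rewrite {2}/V big_geq // scaler0 oppr0 expr0 scale1r sub0r opprK; done.
move=> k /andP[_ kj]; rewrite mulmxBr mul_mx_scalar -!scalemxAl VS // opprK.
rewrite scalerBr addrAC subrK scalerA -exprS addrC; done.
Qed.
End Polynomial.

Section Pole.
(* a1, a2 and z are meant to be already shifted by the pole; b1, b2 and y are
   their inverses *)
Variables (a1 a2 b1 b2 N : 'M[K]_n) (z y : K) (j : nat).
Hypotheses (a1b1 : a1 *m b1 = 1%:M) (b2a2 : b2 *m a2 = 1%:M) (zy : z * y = 1).

Definition pole_dd : 'M[K]_n :=
  - \sum_(1 <= i < j.+1) b1 ^+ (j.+1 - i) *m N *m b2 ^+ i.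

Definition pole_quot B : 'M[K]_n :=
  - \sum_(1 <= k < j.+1) y ^+ k *: B ^+ (j.+1 - k).

Lemma pole_quotE B : pole_quot B = \sum_(1 <= k < j.+1) y ^+ k *: - B ^+ (j.+1 - k).
Proof. by rewrite /pole_quot -sumrN; apply: eq_bigr => k _; rewrite scalerN. Qed.

Definition pole_dd2 : 'M[K]_n :=
  \sum_(1 <= k < j.+1) y ^+ k *:
    \sum_(k <= i < j.+1) b1 ^+ (j.+1 - i) *m N *m b2 ^+ (i.+1 - k).

Lemma pole_ddE : a1 *m pole_dd - pole_dd *m a2 = b1 ^+ j *m N - N *m b2 ^+ j.
Proof.
rewrite /pole_dd mulmxN mulNmx -opprD mulmx_sumr mulmx_suml -sumrB big_add1 /=.
rewrite (GRing.telescope_sumr_eq (fun i => b1 ^+ (j - i) *m N *m b2 ^+ i)) //.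
  by rewrite subnn subn0 !expr0 -/(1%:M) mul1mx mulmx1 opprB.
move=> i /andP[_ ij]; rewrite subSS.
have -> : (j - i = (j - i.+1).+1)%N by lia.
congr (_ - _); first by rewrite mxpowS !mulmxA a1b1 mul1mx.
by rewrite [b2 ^+ _]mxpowSr -!mulmxA b2a2 mulmx1.
Qed.

Lemma pole_quotEl : (a1 - z%:M) *m pole_quot b1 = b1 ^+ j - (y ^+ j)%:M.
Proof.
rewrite /pole_quot mulmxN mulmx_sumr big_add1 /=.
rewrite (GRing.telescope_sumr_eq (fun k => y ^+ k *: b1 ^+ (j - k))) //.
  by rewrite subnn subn0 !expr0 -/(1%:M) scale1r scalemx1 opprB.
move=> k /andP[_ kj]; rewrite subSS.
have -> : (j - k = (j - k.+1).+1)%N by lia.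
rewrite mulmxBl mul_scalar_mx -scalemxAr scalerA exprS mulrA zy mul1r.
by rewrite mxpowS mulmxA a1b1 mul1mx.
Qed.

Lemma pole_quotEr : pole_quot b2 *m (a2 - z%:M) = b2 ^+ j - (y ^+ j)%:M.
Proof.
rewrite /pole_quot mulNmx mulmx_suml big_add1 /=.
rewrite (GRing.telescope_sumr_eq (fun k => y ^+ k *: b2 ^+ (j - k))) //.
  by rewrite subnn subn0 !expr0 -/(1%:M) scale1r scalemx1 opprB.
move=> k /andP[_ kj]; rewrite subSS.
have -> : (j - k = (j - k.+1).+1)%N by lia.
rewrite mulmxBr mul_mx_scalar -scalemxAl scalerA exprS mulrA zy mul1r.
by rewrite mxpowSr -mulmxA b2a2 mulmx1.
Qed.

(** As in [poly_dd2E], with the recurrence [V k a2 = V (k+1) + b1^(j-k) N]. *)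
Lemma pole_dd2E : pole_dd2 *m (a2 - z%:M) = pole_dd - pole_quot b1 *m N.
Proof.
pose V k := \sum_(k.+1 <= i < j.+1) b1 ^+ (j.+1 - i) *m N *m b2 ^+ (i - k).
have VS k : (k < j)%N -> V k *m a2 = V k.+1 + b1 ^+ (j - k) *m N.
  move=> kj; rewrite /V mulmx_suml big_ltn ?ltnS // subSS addrC.
  congr (_ + _).
    apply: eq_big_nat => i /andP[ki _].
    have -> : (i - k = (i - k.+1).+1)%N by lia.
    by rewrite mxpowSr -!mulmxA b2a2 mulmx1.
  by rewrite subSnn expr1 -!mulmxA b2a2 mulmx1.
have -> : pole_dd = - V 0%N.
  by congr (- _); apply: eq_bigr => i _; rewrite subn0.
have -> : pole_dd2 = \sum_(0 <= k < j) y ^+ k.+1 *: V k.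
  by rewrite /pole_dd2 big_add1.
rewrite /pole_quot mulNmx opprK mulmx_suml big_add1 /= mulmx_suml.
apply/eqP; rewrite -subr_eq -sumrB; apply/eqP.
rewrite (GRing.telescope_sumr_eq (fun k => y ^+ k *: V k)) //.
  by rewrite {1}/V big_geq // scaler0 expr0 scale1r sub0r.
move=> k /andP[_ kj]; rewrite subSS mulmxBr mul_mx_scalar -!scalemxAl VS //.
rewrite scalerDr scalerA exprS mulrA zy mul1r -exprS addrAC addrK; done.
Qed.
End Pole.
End ScalarTerms.

(** * Rational matrix functions as sums of monomials *)

(** Reorganises the transformed function, given by its coefficients, into
    contributions of the single coefficients of [G]. *)
Lemma sum_triangle (V : zmodType) (F : nat -> nat -> V) (r : nat) :
  \sum_(0 <= k < r) \sum_(k.+1 <= j < r) F k j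
  = \sum_(0 <= j < r) \sum_(0 <= k < j) F k j.
Proof.
elim: r => [|r IH]; first by rewrite !big_geq.
rewrite big_nat_recr //= [in RHS]big_nat_recr //= -IH.
rewrite [X in _ + X = _]big_geq // addr0 -big_split /=.
by apply: eq_big_nat => k kr; rewrite big_nat_recr.
Qed.

Lemma sum_triangle1 (V : zmodType) (F : nat -> nat -> V) (r : nat) :
  \sum_(1 <= k < r.+1) \sum_(k <= j < r.+1) F k j
  = \sum_(1 <= j < r.+1) \sum_(1 <= k < j.+1) F k j.
Proof.
elim: r => [|r IH]; first by rewrite !big_geq.
rewrite big_nat_recr //= [in RHS]big_nat_recr //= -IH.
rewrite [X in _ = _ + X]big_nat_recr //= addrA big_nat1; congr (_ + _).
rewrite -big_split /=; apply: eq_big_nat => k /andP[_ kr].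
by rewrite big_nat_recr //=; rewrite ltnW.
Qed.

(** The part of the transformed function that comes from a quotient or a second
    divided difference, itself a linear combination [\sum_k z k *: _]. *)
Lemma sum_conjugate (K : fieldType) (m n : nat) (r : seq nat) (z : nat -> K)
    (a b e : nat -> 'M[K]_n) (M : 'M[K]_m) (P : 'M[K]_(m, n)) (T : 'M[K]_n)
    (B : 'M[K]_(n, m)) :
  - (M *m P *m (\sum_(k <- r) z k *: a k) *m T *m B)
    + (P *m T *m (\sum_(k <- r) z k *: b k) *m B *m M
       - P *m T *m (\sum_(k <- r) z k *: e k) *m T *m B)
  = \sum_(k <- r) z k *: (- (M *m (P *m a k *m T *m B))
      + (P *m T *m b k *m B *m M - P *m T *m e k *m T *m B)).
Proof.
have E (p q : nat) (X : 'M[K]_(p, n)) (Y : 'M[K]_(n, q)) (f : nat -> 'M[K]_n) :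
    X *m (\sum_(k <- r) z k *: f k) *m Y = \sum_(k <- r) z k *: (X *m f k *m Y).
  rewrite mulmx_sumr mulmx_suml; apply: eq_bigr => k _.
  by rewrite -scalemxAr -scalemxAl.
rewrite -!(mulmxA _ T B) -!(mulmxA _ B M) !E -!sumrN -!big_split /=.
by apply: eq_bigr => k _; rewrite !scalerDr !scalerN !mulmxA.
Qed.

Section Terms.
Variables (R : realType) (m : nat) (G : ratmx R m).

(** [(None, k)] stands for [z ^ k] and [(Some s, k)] for [(z - c_s) ^ - k]. With
    a single index for both kinds, every identity about [G] is proved monomial
    by monomial. *)
Definition monomial : eqType := (option 'I_(npoles G) * nat)%type.

Definition monomials : seq monomial :=
  [seq (None, k) | k <- index_iota 0 (deg G).+1] ++
  [seq (Some s, k) | s <- index_enum 'I_(npoles G), k <- index_iota 1 (mult s).+1].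

Lemma sum_monomials (V : zmodType) (f : monomial -> V) :
  \sum_(a <- monomials) f a = \sum_(0 <= k < (deg G).+1) f (None, k)
  + \sum_(s < npoles G) \sum_(1 <= k < (mult s).+1) f (Some s, k).
Proof. by rewrite /monomials big_cat big_map big_allpairs_dep. Qed.

Implicit Types (a : monomial) (z : R[i]) (p : R * R).

Definition term_coef a p : 'M[R[i]]_m :=
  match a with (None, k) => coef G k p | (Some s, k) => pcoef s k p end.

Definition term_val a z : R[i] :=
  match a with (None, k) => z ^+ k | (Some s, k) => (z - pole s) ^- k end.

Lemma ratmx_evalE z p : ratmx_eval G z p = - \sum_(a <- monomials) term_val a z *: term_coef a p.
Proof. by rewrite sum_monomials opprD. Qed.

Variable n : nat.
Implicit Types (A N : 'M[R[i]]_n).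

Definition term_mx a A : 'M[R[i]]_n :=
  match a with
  | (None, k) => A ^+ k
  | (Some s, k) => invmx (A - (pole s)%:M) ^+ k
  end.

(** With [g] the monomial [a]: [term_dd], [term_quot] and [term_dd2] are the divided
    differences [g[A1, A2]], [g[A, z]] and [g[A1, A2, z]], where [A1] multiplies
    [N] on the left and [A2] on the right. *)
Definition term_dd a A1 A2 N : 'M[R[i]]_n :=
  match a with
  | (None, k) => poly_dd A1 A2 N k
  | (Some s, k) => pole_dd (invmx (A1 - (pole s)%:M)) (invmx (A2 - (pole s)%:M)) N k
  end.

Definition term_quot a A z : 'M[R[i]]_n :=
  match a with
  | (None, k) => poly_quot z k A
  | (Some s, k) => pole_quot (z - pole s)^-1 k (invmx (A - (pole s)%:M))
  end.

Definition term_dd2 a A1 A2 N z : 'M[R[i]]_n :=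
  match a with
  | (None, k) => poly_dd2 A1 A2 N z k
  | (Some s, k) =>
      pole_dd2 (invmx (A1 - (pole s)%:M)) (invmx (A2 - (pole s)%:M)) N (z - pole s)^-1 k
  end.

Definition offspec A := forall s : 'I_(npoles G), A - (pole s)%:M \in unitmx.

Lemma term_ddE a A1 A2 N : offspec A1 -> offspec A2 ->
  A1 *m term_dd a A1 A2 N - term_dd a A1 A2 N *m A2 = term_mx a A1 *m N - N *m term_mx a A2.
Proof.
move=> h1 h2; case: a => [[s|] k] /=; last exact: poly_ddE.
rewrite -(pole_ddE _ _ (mulmxV (h1 s)) (mulVmx (h2 s))).
set X := pole_dd _ _ _ _; rewrite mulmxBl mulmxBr.
by rewrite mul_scalar_mx mul_mx_scalar opprB addrA subrK.
Qed.

Lemma term_quotEl a A z : offspec A -> (forall s : 'I_(npoles G), z != pole s) ->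
  (A - z%:M) *m term_quot a A z = term_mx a A - (term_val a z)%:M.
Proof.
move=> h hz; case: a => [[s|] k] /=; last exact: poly_quotEl.
rewrite (sub_shift_mx A z (pole s)) (pole_quotEl _ (mulmxV (h s))) ?exprVn //.
by rewrite divff // subr_eq0.
Qed.

Lemma term_quotEr a A z : offspec A -> (forall s : 'I_(npoles G), z != pole s) ->
  term_quot a A z *m (A - z%:M) = term_mx a A - (term_val a z)%:M.
Proof.
move=> h hz; case: a => [[s|] k] /=; last exact: poly_quotEr.
rewrite (sub_shift_mx A z (pole s)) (pole_quotEr _ (mulVmx (h s))) ?exprVn //.
by rewrite divff // subr_eq0.
Qed.

Lemma term_dd2E a A1 A2 N z : offspec A2 -> (forall s : 'I_(npoles G), z != pole s) ->
  term_dd2 a A1 A2 N z *m (A2 - z%:M) = term_dd a A1 A2 N - term_quot a A1 z *m N.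
Proof.
move=> h hz; case: a => [[s|] k] /=; last exact: poly_dd2E.
rewrite (sub_shift_mx A2 z (pole s)) (pole_dd2E _ _ _ (mulVmx (h s))) //.
by rewrite divff // subr_eq0.
Qed.

Variables (A1 A2 : 'M[R[i]]_n) (Pi1 Pi2 : R * R -> 'M[R[i]]_(n, m)).
Variable S : R * R -> 'M[R[i]]_n.

Lemma rhs_Pi1E p :
  rhs_Pi1 A1 Pi1 G p = \sum_(a <- monomials) term_mx a A1 *m Pi1 p *m term_coef a p.
Proof.
rewrite sum_monomials /rhs_Pi1; congr (_ + _); apply: eq_bigr => s _.
by apply: eq_bigr => k _; rewrite mxexpz_opp.
Qed.

Lemma rhs_Pi2E p :
  rhs_Pi2 A2 Pi2 G p = - \sum_(a <- monomials) term_coef a p *m (Pi2 p)^t* *m term_mx a A2.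
Proof.
rewrite sum_monomials /rhs_Pi2; congr (- (_ + _)); apply: eq_bigr => s _.
by apply: eq_bigr => k _; rewrite mxexpz_opp.
Qed.

Lemma rhs_SE p : rhs_S A1 A2 Pi1 Pi2 G p
  = \sum_(a <- monomials) term_dd a A1 A2 (Pi1 p *m term_coef a p *m (Pi2 p)^t*).
Proof.
rewrite sum_monomials /rhs_S [X in _ = X + _]big_ltn //.
have -> N : term_dd (None, 0%N) A1 A2 N = 0 by rewrite /= /poly_dd big_geq.
rewrite add0r; apply: f_equal2.
  by apply: eq_bigr => k _; apply: eq_bigr => j _; rewrite !mulmxA.
rewrite -sumrN; apply: eq_bigr => s _; rewrite -sumrN; apply: eq_bigr => k _.
rewrite /= /pole_dd; congr (- _); apply: eq_big_nat => j /andP[_ jk].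
have -> : (j%:Z - k%:Z - 1 = - (k.+1 - j)%N%:Z)%R by lia.
by rewrite !mxexpz_opp !mulmxA.
Qed.

Definition term_transform a z p : 'M[R[i]]_m :=
  let P := (Pi2 p)^t* in let T := invmx (S p) in let M := term_coef a p in
  term_val a z *: M - M *m P *m term_quot a A2 z *m T *m Pi1 p
  + P *m T *m term_quot a A1 z *m Pi1 p *m M
  - P *m T *m term_dd2 a A1 A2 (Pi1 p *m M *m P) z *m T *m Pi1 p.

Lemma ratmx_eval_transform z p :
  ratmx_eval (transform A1 A2 Pi1 Pi2 S G) z p = - \sum_(a <- monomials) term_transform a z p.
Proof.
rewrite sum_monomials /ratmx_eval opprD /=; congr (- _ + - _).
- rewrite /tr_coef.
  under eq_bigr => k _ do rewrite scalerBr scaler_sumr.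
  rewrite sumrB sum_triangle -sumrB; apply: eq_bigr => j _.
  rewrite /term_transform /= -!addrA; congr (_ + _).
  rewrite /poly_quot /poly_dd2 sum_conjugate -sumrN.
  apply: eq_bigr => k _; rewrite -scalerN /trX /trY !opprD opprK -!addrA.
  congr (_ *: (_ + (_ - _))).
  by rewrite mulmx_sumr !mulmx_suml; apply: eq_bigr => i _; rewrite !mulmxA.
- apply: eq_bigr => s _; rewrite /tr_pcoef.
  under eq_bigr => k _ do rewrite scalerDr scaler_sumr.
  rewrite big_split sum_triangle1 -big_split; apply: eq_bigr => j _.
  rewrite /term_transform /= -!addrA; congr (_ + _).
  rewrite !pole_quotE /pole_dd2 sum_conjugate.
  apply: eq_big_nat => k /andP[k1 kj]; rewrite /trXpole /trYpole exprVn.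
  have -> : (k%:Z - j%:Z - 1 = - (j.+1 - k)%N%:Z)%R by lia.
  rewrite !mxexpz_opp !(mulmxN, mulNmx) opprK -!addrA.
  congr (_ *: (_ + (_ - _))).
  rewrite mulmx_sumr !mulmx_suml; apply: eq_big_nat => i /andP[ki ij].
  have -> : (k%:Z - i%:Z - 1 = - (i.+1 - k)%N%:Z)%R by lia.
  have -> : (i%:Z - j%:Z - 1 = - (j.+1 - i)%N%:Z)%R by lia.
  by rewrite !mxexpz_opp !mulmxA.
Qed.

End Terms.

(** * The Darboux matrix *)

Section DarbouxTerm.
Variables (K : fieldType) (m n : nat).
Variables (A1 A2 S T R1 R2 : 'M[K]_n) (B : 'M[K]_(n, m)) (P : 'M[K]_(m, n)) (z : K).
Hypotheses (ST : S *m T = 1%:M) (TS : T *m S = 1%:M).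
Hypothesis identity : A1 *m S - S *m A2 = B *m P.
Hypothesis AR1 : (A1 - z%:M) *m R1 = 1%:M.

Let W : 'M[K]_m := 1%:M - P *m T *m R1 *m B.

Let identity_z : B *m P = (A1 - z%:M) *m S - S *m (A2 - z%:M).
Proof.
rewrite -identity mulmxBl mulmxBr mul_scalar_mx mul_mx_scalar.
by rewrite opprB addrA subrK.
Qed.

(** Source of all the cancellations: [T B P T = T (A1 - z) - (A2 - z) T] by the
    operator identity. *)
Lemma mul_TBW : T *m B *m W = (A2 - z%:M) *m T *m R1 *m B.
Proof.
rewrite /W mulmxBr mulmx1 !mulmxA -(mulmxA T B P) identity_z.
rewrite mulmxBr !mulmxA TS mul1mx !mulmxBl.
rewrite -[T *m _ *m S *m T]mulmxA ST mulmx1 -[T *m _ *m R1]mulmxA AR1 mulmx1.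
by rewrite opprB addrC subrK.
Qed.

Lemma mul_WV : R1 *m (A1 - z%:M) = 1%:M -> (A2 - z%:M) *m R2 = 1%:M ->
  W *m (1%:M + P *m R2 *m T *m B) = 1%:M.
Proof.
move=> R1A AR2.
have WP : W *m P = P *m T *m R1 *m S *m (A2 - z%:M).
  rewrite /W mulmxBl mul1mx -(mulmxA _ B P) identity_z mulmxBr !mulmxA.
  rewrite -[P *m T *m R1 *m (A1 - _)]mulmxA R1A mulmx1.
  by rewrite -[P *m T *m S]mulmxA TS mulmx1 opprB addrC subrK.
rewrite mulmxDr mulmx1 !mulmxA WP -[_ *m (A2 - _) *m R2]mulmxA AR2 mulmx1.
by rewrite -[_ *m S *m T]mulmxA ST mulmx1 /W subrK.
Qed.

Variables (M : 'M[K]_m) (g : K) (g1 g2 h1 h2 dd E : 'M[K]_n).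
Hypothesis h1E : R1 *m g1 = h1 + g *: R1.
Hypothesis h2E : h2 *m (A2 - z%:M) = g2 - g%:M.
Hypothesis EE : E *m (A2 - z%:M) = dd - h1 *m (B *m M *m P).

(** The contribution of one monomial of [G] to [W_x = Gtilde W - W G]; all
    divided differences at [z] disappear because of [mul_TBW]. *)
Lemma darboux_term :
  M *m P *m g2 *m T *m R1 *m B + P *m T *m dd *m T *m R1 *m B
    - P *m T *m R1 *m g1 *m B *m M
  = - ((g *: M - M *m P *m h2 *m T *m B + P *m T *m h1 *m B *m M
        - P *m T *m E *m T *m B) *m W) + g *: (W *m M).
Proof.
have e1 : M *m P *m h2 *m T *m B *m W
    = M *m P *m g2 *m T *m R1 *m B - g *: (M *m P *m T *m R1 *m B).
  rewrite -(mulmxA _ T B) -(mulmxA _ (T *m B) W) mul_TBW !mulmxA.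
  rewrite -(mulmxA _ h2) h2E mulmxBr mul_mx_scalar !mulmxBl.
  by rewrite -!scalemxAl.
have e2 : P *m T *m E *m T *m B *m W
    = P *m T *m dd *m T *m R1 *m B
      - P *m T *m h1 *m B *m M *m P *m T *m R1 *m B.
  rewrite -(mulmxA _ T B) -(mulmxA _ (T *m B) W) mul_TBW !mulmxA.
  by rewrite -(mulmxA _ E) EE mulmxBr !mulmxBl !mulmxA.
rewrite !(mulmxBl, mulmxDl) e1 e2 -(mulmxA (P *m T) R1 g1) h1E.
rewrite /W ?(mulmxBr, mulmxBl, mulmxDr, mulmxDl) ?(mulmx1, mul1mx).
rewrite -?scalemxAr -?scalemxAl ?mulmxN ?mulmxA.
mx_lin.
Qed.

End DarbouxTerm.

Lemma darboux_rhs_linear (K : fieldType) (m n : nat) (T R1 US : 'M[K]_n)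
    (P U2 : 'M[K]_(m, n)) (B U1 : 'M[K]_(n, m)) :
  - (((- U2 *m T - P *m (T *m US *m T)) *m R1) *m B + P *m T *m R1 *m U1)
  = U2 *m T *m R1 *m B + P *m T *m US *m T *m R1 *m B - P *m T *m R1 *m U1.
Proof. by rewrite !mulmxBl !mulNmx !mulmxA; mx_lin. Qed.

Lemma gauge_linear (K : fieldType) (m : nat) (I : Type) (r : seq I) (W : 'M[K]_m)
    (Gs M : I -> 'M[K]_m) (g : I -> K) :
  - (\sum_(a <- r) Gs a) *m W - W *m (- \sum_(a <- r) g a *: M a)
  = \sum_(a <- r) (- (Gs a *m W) + g a *: (W *m M a)).
Proof.
rewrite mulNmx mulmxN opprK mulmx_suml mulmx_sumr -sumrN -big_split /=.
by apply: eq_bigr => a _; rewrite -scalemxAr.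
Qed.

Section DarbouxEquation.
Variables (R : realType) (m n : nat) (G : ratmx R m).
Variables (A1 A2 : 'M[R[i]]_n) (Pi1 Pi2 : R * R -> 'M[R[i]]_(n, m)).
Variable S : R * R -> 'M[R[i]]_n.
Variables (z : R[i]) (p : R * R).
Hypotheses (hA1 : offspec G A1) (hA2 : offspec G A2).
Hypothesis hz : forall s : 'I_(npoles G), z != pole s.
Hypothesis SU : S p \in unitmx.
Hypothesis identity : A1 *m S p - S p *m A2 = Pi1 p *m (Pi2 p)^t*.
Hypothesis hz1 : A1 - z%:M \in unitmx.

Let P := (Pi2 p)^t*.
Let T := invmx (S p).
Let R1 := invmx (A1 - z%:M).
Let W := 1%:M - P *m T *m R1 *m Pi1 p.

Lemma darboux_rhs :
  - (((rhs_Pi2 A2 Pi2 G p *m T - P *m (T *m rhs_S A1 A2 Pi1 Pi2 G p *m T)) *m R1)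
       *m Pi1 p + P *m T *m R1 *m rhs_Pi1 A1 Pi1 G p)
  = ratmx_eval (transform A1 A2 Pi1 Pi2 S G) z p *m W - W *m ratmx_eval G z p.
Proof.
pose lhs (a : monomial G) :=
  term_coef a p *m P *m term_mx a A2 *m T *m R1 *m Pi1 p +
  P *m T *m term_dd a A1 A2 (Pi1 p *m term_coef a p *m P) *m T *m R1 *m Pi1 p
  - P *m T *m R1 *m term_mx a A1 *m Pi1 p *m term_coef a p.
transitivity (\sum_(a <- monomials G) lhs a).
  rewrite rhs_Pi1E rhs_Pi2E rhs_SE darboux_rhs_linear /lhs sumrB big_split /=.
  congr (_ + _ - _).
  - by rewrite !mulmx_suml.
  - by rewrite mulmx_sumr !mulmx_suml.
  - by rewrite mulmx_sumr; apply: eq_bigr => a _; rewrite !mulmxA.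
rewrite ratmx_eval_transform ratmx_evalE gauge_linear.
apply: eq_bigr => a _.
apply: (@darboux_term _ _ _ A1 A2 (S p) T R1 (Pi1 p) P z).
- exact: mulmxV.
- exact: mulVmx.
- exact: identity.
- exact: mulmxV.
- apply: (can_inj (mulKmx hz1)); rewrite mulmxDr mulKVmx // -scalemxAr mulmxV //.
  by rewrite term_quotEl // scalemx1 subrK.
- exact: term_quotEr.
- exact: term_dd2E.
Qed.

End DarbouxEquation.

(** * Algebra of the linear systems and of the zero curvature equation *)

Lemma offspecP (R : realType) m (G : ratmx R m) n (A : 'M[R[i]]_n) :
  poles_avoid_spectrum G A -> offspec G A.
Proof.
move=> h s; rewrite -row_free_unit -kermx_eq0.
by have := h s; rewrite /eigenvalue /eigenspace negbK.
Qed.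

Lemma mem_monomials (R : realType) m (G : ratmx R m)
    (Q : (R * R -> 'M[R[i]]_m) -> Prop) :
  all_coefs Q G -> forall a, a \in monomials G -> Q (term_coef a).
Proof.
move=> [hc hp] a; rewrite mem_cat => /orP[/mapP[k]|/allpairsPdep[s [k []]]].
  by rewrite mem_index_iota ltnS => kG ->; exact: hc.
by move=> _; rewrite mem_index_iota ltnS => kG ->; exact: hp.
Qed.

(** Monomial by monomial this is
    [A1 g[A1, A2] - g[A1, A2] A2 = g(A1) - g(A2)]. *)
Lemma identity_rhs (R : realType) m n (G : ratmx R m) (A1 A2 : 'M[R[i]]_n)
    (Pi1 Pi2 : R * R -> 'M[R[i]]_(n, m)) p :
  offspec G A1 -> offspec G A2 ->
  A1 *m rhs_S A1 A2 Pi1 Pi2 G p - rhs_S A1 A2 Pi1 Pi2 G p *m A2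
  = rhs_Pi1 A1 Pi1 G p *m (Pi2 p)^t* + Pi1 p *m rhs_Pi2 A2 Pi2 G p.
Proof.
move=> h1 h2; rewrite rhs_SE rhs_Pi1E rhs_Pi2E mulmxN.
rewrite !mulmx_sumr !mulmx_suml -!sumrB; apply: eq_bigr => a _.
by rewrite term_ddE // !mulmxA.
Qed.

(** The second hypothesis equates the mixed derivatives of [W], computed from
    [W_x = Gs W - W G] and [W_t = Fs W - W F]; their difference is
    [(Gst - Fsx + [Gs, Fs]) W - W (Gt - Fx + [G, F])], where [Gst] and [Fsx]
    are the derivatives of [Gs] in t and of [Fs] in x. *)
Lemma zero_curvature_transport (K : fieldType) m (W V Gt Fx G F Gst Fsx Gs Fs : 'M[K]_m) :
  W *m V = 1%:M ->
  Gst *m W + Gs *m (Fs *m W - W *m F) - ((Fs *m W - W *m F) *m G + W *m Gt)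
  = Fsx *m W + Fs *m (Gs *m W - W *m G) - ((Gs *m W - W *m G) *m F + W *m Fx) ->
  Gt - Fx + (G *m F - F *m G) = 0 ->
  Gst - Fsx + (Gs *m Fs - Fs *m Gs) = 0.
Proof.
move=> WV e0 e1; apply: (can_inj (mulmxK (mulmx1_unit WV).1)); rewrite mul0mx.
rewrite -(mulmx0 _ W) -e1.
move: e0; rewrite !(mulmxBl, mulmxBr, mulmxDl, mulmxDr, mulmxN, mulNmx, mulmxA) => e0.
apply/eqP; rewrite -subr_eq0; apply/eqP.
move/eqP: e0; rewrite -subr_eq0 => /eqP; apply: etrans.
mx_lin.
Qed.

(** * Continuity of the solutions of the linear systems *)

Section ContinuityOfData.
Variables (R : realType) (T : Type) (F : set_system T).
Context {FF : Filter F}.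

(** The growth condition under which [joint_continuity] applies to an equation
    [f_x = phi]. *)
Definition lin_bounded m n m' n' (f : T -> 'M[R[i]]_(m, n))
    (phi : T -> 'M[R[i]]_(m', n')) : Prop :=
  exists2 K : R, 0 <= K & \forall x \near F, mxl1 (phi x) <= K * (1 + mxl1 (f x)).

Lemma lin_bounded_sum m n m' n' (f : T -> 'M[R[i]]_(m, n)) (I : eqType) (r : seq I)
    (phi : I -> T -> 'M[R[i]]_(m', n')) :
  (forall i, i \in r -> lin_bounded f (phi i)) ->
  lin_bounded f (fun x => \sum_(i <- r) phi i x).
Proof.
elim: r => [|a r IH] h.
  by exists 0 => //; apply: nearW => x; rewrite big_nil mxl10 mul0r.
have [K K0 hK] := h a (mem_head _ _).
have [K' K'0 hK'] := IH (fun i ir => h i (mem_behead (s := a :: r) ir)).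
exists (K + K'); first exact: addr_ge0.
apply: filterS2 hK hK' => x h1 h2; rewrite big_cons mulrDl.
by apply: le_trans (mxl1D _ _) _; apply: lerD.
Qed.

Lemma lin_bounded_cvg m n m' n' (f : T -> 'M[R[i]]_(m, n))
    (phi : T -> 'M[R[i]]_(m', n')) (L : 'M[R[i]]_(m', n')) :
  phi @ F --> L -> lin_bounded f phi.
Proof.
move=> hphi; have L0 := mxl1_ge0 L.
exists (mxl1 L + 1); first by rewrite addr_ge0.
apply: filterS (cvg_mx_bounded hphi) => x; have := mxl1_ge0 (f x); nra.
Qed.

Lemma lin_bounded_id m n (f : T -> 'M[R[i]]_(m, n)) : lin_bounded f f.
Proof. by exists 1 => //; apply: nearW => x; rewrite mul1r lerDr. Qed.

Lemma lin_boundedMr m n m' n' k (f : T -> 'M[R[i]]_(m, n))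
    (phi : T -> 'M[R[i]]_(m', n')) (c : T -> 'M[R[i]]_(n', k)) (L : 'M[R[i]]_(n', k)) :
  c @ F --> L -> lin_bounded f phi -> lin_bounded f (fun x => phi x *m c x).
Proof.
move=> hc [K K0 hK]; have L0 := mxl1_ge0 L.
exists (K * (mxl1 L + 1)); first by apply: mulr_ge0 => //; rewrite addr_ge0.
apply: filterS2 hK (cvg_mx_bounded hc) => x h1 h2.
apply: le_trans (mxl1M _ _) _; rewrite mulrAC.
by apply: ler_pM => //; apply: mxl1_ge0.
Qed.

Lemma lin_boundedMl m n m' n' k (f : T -> 'M[R[i]]_(m, n))
    (phi : T -> 'M[R[i]]_(m', n')) (c : T -> 'M[R[i]]_(k, m')) (L : 'M[R[i]]_(k, m')) :
  c @ F --> L -> lin_bounded f phi -> lin_bounded f (fun x => c x *m phi x).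
Proof.
move=> hc [K K0 hK]; have L0 := mxl1_ge0 L.
exists ((mxl1 L + 1) * K); first by apply: mulr_ge0 => //; rewrite addr_ge0.
apply: filterS2 hK (cvg_mx_bounded hc) => x h1 h2.
apply: le_trans (mxl1M _ _) _; rewrite -mulrA.
by apply: ler_pM => //; apply: mxl1_ge0.
Qed.

Lemma lin_boundedN m n m' n' (f : T -> 'M[R[i]]_(m, n)) (phi : T -> 'M[R[i]]_(m', n')) :
  lin_bounded f phi -> lin_bounded f (fun x => - phi x).
Proof.
by move=> [K K0 hK]; exists K => //; apply: filterS hK => x; rewrite mxl1N.
Qed.

End ContinuityOfData.

(** The solutions of the linear systems are only assumed to have partial
    derivatives; their joint continuity comes from the linear growth of the
    right-hand sides of the x-equations. *)
Lemma continuous_of_partials (R : realType) (b1 b2 : \bar R) m n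
    (f phi chi : R * R -> 'M[R[i]]_(m, n)) :
  (forall p, domain b1 b2 p -> is_dx (domain b1 b2) f p (phi p)) ->
  (forall p, domain b1 b2 p -> is_dt (domain b1 b2) f p (chi p)) ->
  (forall p, domain b1 b2 p ->
     lin_bounded (within (domain b1 b2) (nbhs p)) f phi) ->
  {within domain b1 b2, continuous f}.
Proof.
move=> fx ft hphi; apply/subspace_continuousP => p Dp.
have [K K0 hK] := hphi p Dp.
apply: (joint_continuity Dp K0 fx hK).
case: p Dp {hK} => x t Dp.
exact: (@der_cvg_nbhs _ _ _ _ (fun y => f (x, y)) t (chi (x, t)) (ft (x, t) Dp)).
Qed.

(** Near [p] the matrix [(S p)^-1 (S q)] is a small perturbation of the
    identity. *)
Lemma regular_points_open (R : realType) (b1 b2 : \bar R) n (S : R * R -> 'M[R[i]]_n) :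
  {within domain b1 b2, continuous S} ->
  forall p, regular_points (domain b1 b2) S p ->
  \forall q \near within (domain b1 b2) (nbhs p), regular_points (domain b1 b2) S q.
Proof.
set D := domain b1 b2; move=> /subspace_continuousP cS p [Dp /= Sp].
have SU : S p \in unitmx by rewrite unitmxE unitfE.
have h : (fun q => mxl1 (invmx (S p) *m S q - 1%:M)) @ within D (nbhs p) --> (0 : R).
  apply/cvg_mxP; rewrite -(mulVmx SU); apply: cvg_mxM; first exact: cvg_cst.
  exact: cS.
near=> q; split; first by near: q; exact: withinT.
suff : S q \in unitmx by rewrite unitmxE unitfE.
have : invmx (S p) *m S q \in unitmx.
  rewrite -[X in X \in _](subrK 1%:M) addrC; apply: unitmx_perturb.
  by near: q; apply: (cvgr_lt _ h).
by rewrite unitmx_mul => /andP[].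
Unshelve. all: by end_near. Qed.

(** * Dependence on the spectral parameter *)

Section SpectralParameter.
Variable R : realType.
Implicit Types (z : R[i]).

Lemma near_neq (a z0 : R[i]) : \forall z \near z0^', z != a.
Proof.
have [->|az] := eqVneq a z0; first exact: withinT.
apply: nbhs_dnbhs; have e0 : 0 < `|z0 - a| by rewrite normr_gt0 subr_eq0 eq_sym.
near=> z; apply/eqP => za.
have : `|z0 - z| < `|z0 - a| by near: z; apply: (nbhsx_ballx z0 _ e0).
by rewrite za ltxx.
Unshelve. all: by end_near. Qed.

Lemma near_notin (s : seq R[i]) (z0 : R[i]) : \forall z \near z0^', z \notin s.
Proof.
elim: s => [|a s IH]; first by apply: nearW.
by apply: filterS2 (near_neq a z0) IH => z za zs; rewrite inE negb_or za.
Qed.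

Lemma near_unitmx_sub n (A : 'M[R[i]]_n) (z0 : R[i]) :
  \forall z \near z0^', A - z%:M \in unitmx.
Proof.
have [s hs] := closed_field_poly_normal (char_poly A).
apply: filterS (near_notin s z0) => z zs.
rewrite -row_free_unit -kermx_eq0; apply/negPn; apply/negP => hz.
have : eigenvalue A z by [].
rewrite eigenvalue_root_char hs (monicP (char_poly_monic A)) scale1r.
by rewrite root_prod_XsubC (negPf zs).
Qed.

Lemma cvg_scalar_mx n (z0 : R[i]) :
  (fun z => z%:M : 'M[R[i]]_n) @ z0^' --> (z0%:M : 'M[R[i]]_n).
Proof.
have cid : (fun z : R[i] => z) @ z0^' --> z0 by exact: nbhs_dnbhs.
have {}cid := (cvgC _ _ _).1 cid.
apply: (cvg_mxl1_le (g := fun z => n%:R * cl1 (z - z0))).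
  apply: nearW => z; rewrite -raddfB /= /mxl1.
  apply: (@le_trans _ _ (\sum_(i < n) cl1 (z - z0))).
    apply: ler_sum => i _; rewrite (bigD1 i) //= mxE eqxx mulr1n big1 ?addr0 //.
    by move=> j ji; rewrite mxE eq_sym (negPf ji) mulr0n /cl1 /= normr0 addr0.
  by rewrite sumr_const card_ord mulr_natl.
by rewrite -(mulr0 n%:R); apply: cvgM; [exact: cvg_cst | exact: cid].
Qed.

Lemma scalar_mx_exp n (c : R[i]) k : (c%:M : 'M[R[i]]_n) ^+ k = (c ^+ k)%:M.
Proof.
elim: k => [|k IH]; first by rewrite !expr0.
by rewrite mxpowS IH mul_scalar_mx scale_scalar_mx exprS.
Qed.

Lemma ratmx_eval_continuous m (G : ratmx R m) p (z0 : R[i]) :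
  (forall s : 'I_(npoles G), z0 != pole s) ->
  (fun z => ratmx_eval G z p) @ z0^' --> ratmx_eval G z0 p.
Proof.
move=> hz.
have cpow (f : R[i] -> 'M[R[i]]_m) (L M : 'M[R[i]]_m) k : f @ z0^' --> L ->
    (fun z => f z ^+ k *m M) @ z0^' --> L ^+ k *m M.
  move=> fc; elim: k => [|k IH].
    rewrite (_ : (fun z => _) = (fun=> M)); last by apply/funext => z; exact: mul1mx.
    by rewrite (_ : _ *m M = M); [exact: cvg_cst | exact: mul1mx].
  rewrite (_ : (fun z => _) = (fun z => f z *m (f z ^+ k *m M))); last first.
    by apply/funext => z; rewrite mxpowS mulmxA.
  by rewrite mxpowS -mulmxA; exact: (cvg_mxM fc IH).
have csum (I : Type) (r : seq I) (f : I -> R[i] -> 'M[R[i]]_m) (L : I -> 'M[R[i]]_m) :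
    (forall i, f i @ z0^' --> L i) ->
    (fun z => \sum_(i <- r) f i z) @ z0^' --> \sum_(i <- r) L i.
  move=> h; elim: r => [|a r IH].
    rewrite big_nil (_ : (fun z => _) = (fun=> 0)); first exact: cvg_cst.
    by apply/funext => z; rewrite big_nil.
  rewrite big_cons.
  rewrite (_ : (fun z => _) = (fun z => f a z + \sum_(i <- r) f i z)).
    by apply: cvg_mxD; [exact: h | exact: IH].
  by apply/funext => z; rewrite big_cons.
rewrite ratmx_evalE.
rewrite (_ : (fun z => _) =
  (fun z => - \sum_(a <- monomials G) term_val a z *: term_coef a p)); last first.
  by apply/funext => z; rewrite ratmx_evalE.
apply: cvg_mxN; apply: csum => a.
case: a => [[s|] k] /=.
- have E (z : R[i]) : (z - pole s) ^- k *: pcoef s k p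
      = invmx (z%:M - (pole s)%:M : 'M[R[i]]_m) ^+ k *m pcoef s k p.
    by rewrite -raddfB /= invmx_scalar scalar_mx_exp exprVn mul_scalar_mx.
  rewrite E (_ : (fun z => _) =
    (fun z => invmx (z%:M - (pole s)%:M : 'M[R[i]]_m) ^+ k *m pcoef s k p)).
    apply: cpow; apply: cvg_invmx.
    - apply: filterS (near_neq (pole s) z0) => z zs; rewrite -raddfB /= unitmxE det_scalar.
      by rewrite unitfE expf_neq0 // subr_eq0.
    - by rewrite -raddfB /= unitmxE det_scalar unitfE expf_neq0 // subr_eq0.
    - by apply: cvg_mxD; [exact: cvg_scalar_mx | exact: cvg_cst].
  by apply/funext => z; rewrite E.
- rewrite -mul_scalar_mx -scalar_mx_exp (_ : (fun z => _) =
    (fun z => (z%:M : 'M[R[i]]_m) ^+ k *m coef G k p)).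
    by apply: cpow; apply: cvg_scalar_mx.
  by apply/funext => z; rewrite scalar_mx_exp mul_scalar_mx.
Qed.

End SpectralParameter.

Section DerivativeOfRatmx.
Variables (R : realType) (m : nat) (Der : (R * R -> 'M[R[i]]_m) -> 'M[R[i]]_m -> Prop).
Hypothesis Der0 : Der (fun=> 0) 0.
Hypothesis DerD : forall f g l k, Der f l -> Der g k -> Der (fun p => f p + g p) (l + k).
Hypothesis DerN : forall f l, Der f l -> Der (fun p => - f p) (- l).
Hypothesis DerZ : forall c f l, Der f l -> Der (fun p => c *: f p) (c *: l).

(** Makes the derivative at [p] an explicit rational function of [z], to which
    [ratmx_eval_continuous] applies. *)
Lemma ratmx_derivative (G : ratmx R m) p :
  all_coefs (fun q => exists l, Der q l) G ->
  exists2 G' : ratmx R m,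
    forall z, (forall s : 'I_(npoles G), z != pole s) ->
      forall s : 'I_(npoles G'), z != pole s
  & forall z, Der (ratmx_eval G z) (ratmx_eval G' z p).
Proof.
move=> [hc hp].
pose G' := RatMx (deg G) (@pole _ _ G) (@mult _ _ G)
  (fun k _ => xget 0 [set l | Der (coef G k) l])
  (fun s k _ => xget 0 [set l | Der (pcoef s k) l]).
exists G' => // z.
have hsum (I : eqType) (r : seq I) (f : I -> R * R -> 'M[R[i]]_m) L :
    (forall i, i \in r -> Der (f i) (L i)) ->
    Der (fun p => \sum_(i <- r) f i p) (\sum_(i <- r) L i).
  elim: r => [|a r IH] h.
    rewrite big_nil (_ : (fun p => _) = (fun=> 0)) //.
    by apply/funext => q; rewrite big_nil.
  rewrite big_cons (_ : (fun p => _) = (fun p => f a p + \sum_(i <- r) f i p)); last first.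
    by apply/funext => q; rewrite big_cons.
  apply: DerD; first by apply: h; rewrite mem_head.
  by apply: IH => i ir; apply: h; rewrite in_cons ir orbT.
rewrite /ratmx_eval; apply: DerD; apply: DerN; apply: (hsum) => k.
  rewrite mem_index_iota ltnS => kG; apply: DerZ.
  by apply: xgetPex; exact: hc.
move=> _; apply: hsum => j; rewrite mem_index_iota ltnS => jG; apply: DerZ.
by apply: xgetPex; exact: hp.
Qed.

End DerivativeOfRatmx.

(** * The transformed coefficients and the transformed equation *)

Section Main.
Variables (R : realType) (b1 b2 : \bar R).
Let D := domain b1 b2.
Variables (m n : nat) (G F : ratmx R m).
Hypothesis hG : all_coefs (fun q => {within D, continuous q} /\ C1_t D q) G.
Hypothesis hF : all_coefs (fun q => {within D, continuous q} /\ differentiable_x D q) F.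
Variables (A1 A2 : 'M[R[i]]_n).
Hypotheses (hGA1 : offspec G A1) (hGA2 : offspec G A2).
Hypotheses (hFA1 : offspec F A1) (hFA2 : offspec F A2).
Variables (Pi1 Pi2 : R * R -> 'M[R[i]]_(n, m)) (S : R * R -> 'M[R[i]]_n).
Let P p := (Pi2 p)^t*.
Hypothesis hPi1x : forall p, D p -> is_dx D Pi1 p (rhs_Pi1 A1 Pi1 G p).
Hypothesis hPi2x : forall p, D p -> is_dx D P p (rhs_Pi2 A2 Pi2 G p).
Hypothesis hSx : forall p, D p -> is_dx D S p (rhs_S A1 A2 Pi1 Pi2 G p).
Hypothesis hPi1t : forall p, D p -> is_dt D Pi1 p (rhs_Pi1 A1 Pi1 F p).
Hypothesis hPi2t : forall p, D p -> is_dt D P p (rhs_Pi2 A2 Pi2 F p).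
Hypothesis hSt : forall p, D p -> is_dt D S p (rhs_S A1 A2 Pi1 Pi2 F p).

(** By [identity_rhs], both partial derivatives of the defect vanish. *)
Lemma operator_identity :
  D (0, 0) -> A1 *m S (0, 0) - S (0, 0) *m A2 = Pi1 (0, 0) *m P (0, 0) ->
  forall p, D p -> A1 *m S p - S p *m A2 = Pi1 p *m P p.
Proof.
move=> D0 h0 p Dp; apply/eqP; rewrite -subr_eq0; apply/eqP.
pose f q := A1 *m S q + - (S q *m A2) + - (Pi1 q *m P q).
have -> : 0 = f (0, 0) by rewrite /f h0 subrr.
apply: (@eq_of_zero_partials _ b1 b2 _ _ f D0 _ _ p Dp) => q Dq.
- have := is_dxD (is_dxD (is_dxM (is_dx_cst D A1 q) (hSx Dq))
      (is_dxN (is_dxM (hSx Dq) (is_dx_cst D A2 q))))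
    (is_dxN (is_dxM (hPi1x Dq) (hPi2x Dq))).
  congr is_dx; rewrite mul0mx mulmx0 add0r addr0.
  by rewrite -(identity_rhs Pi1 Pi2 q hGA1 hGA2) subrr.
- have := is_dtD (is_dtD (is_dtM (is_dt_cst D A1 q) (hSt Dq))
      (is_dtN (is_dtM (hSt Dq) (is_dt_cst D A2 q))))
    (is_dtN (is_dtM (hPi1t Dq) (hPi2t Dq))).
  congr is_dt; rewrite mul0mx mulmx0 add0r addr0.
  by rewrite -(identity_rhs Pi1 Pi2 q hFA1 hFA2) subrr.
Qed.

Let contG : all_coefs (fun q => {within D, continuous q}) G.
Proof. by move: hG => [hc hp]; split=> [k /hc[]|s k /hp[]]. Qed.

Let contF : all_coefs (fun q => {within D, continuous q}) F.
Proof. by move: hF => [hc hp]; split=> [k /hc[]|s k /hp[]]. Qed.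

Let contG_at p : D p -> forall a, a \in monomials G ->
  term_coef a @ within D (nbhs p) --> term_coef a p.
Proof.
by move=> Dp a aG; have /subspace_continuousP := mem_monomials contG aG; apply.
Qed.

Lemma continuous_Pi1 : {within D, continuous Pi1}.
Proof.
apply: (continuous_of_partials hPi1x hPi1t) => p Dp.
rewrite (_ : rhs_Pi1 A1 Pi1 G = fun q =>
    \sum_(a <- monomials G) term_mx a A1 *m Pi1 q *m term_coef a q); last first.
  by apply/funext => q; rewrite rhs_Pi1E.
apply: lin_bounded_sum => a aG; apply: lin_boundedMr (contG_at Dp aG) _.
by apply: lin_boundedMl (cvg_cst _) _; apply: lin_bounded_id.
Qed.

Lemma continuous_Pi2 : {within D, continuous P}.
Proof.
apply: (continuous_of_partials hPi2x hPi2t) => p Dp.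
rewrite (_ : rhs_Pi2 A2 Pi2 G = fun q =>
    - \sum_(a <- monomials G) term_coef a q *m P q *m term_mx a A2); last first.
  by apply/funext => q; rewrite rhs_Pi2E.
apply: lin_boundedN; apply: lin_bounded_sum => a aG.
apply: lin_boundedMr (cvg_cst _) _; apply: lin_boundedMl (contG_at Dp aG) _.
exact: lin_bounded_id.
Qed.

Lemma continuous_S : {within D, continuous S}.
Proof.
apply: (continuous_of_partials hSx hSt) => p Dp.
have /subspace_continuousP /(_ p Dp) c := mxclass_rhs_S (continuous_class D)
  A1 A2 continuous_Pi1 continuous_Pi2 contG.
exact: lin_bounded_cvg c.
Qed.

Let U := regular_points D S.

Let UD : U `<=` D.
Proof. by move=> p []. Qed.

Let Uopen p : U p -> \forall q \near within D (nbhs p), U q.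
Proof. by apply: regular_points_open; exact: continuous_S. Qed.

Let SU p : U p -> S p \in unitmx.
Proof. by move=> [_ /=]; rewrite unitmxE unitfE. Qed.

Let dxU k l (f : R * R -> 'M[R[i]]_(k, l)) p d : U p -> is_dx D f p d -> is_dx U f p d.
Proof. by move=> Up; rewrite (is_dx_open UD Uopen). Qed.

Let dtU k l (f : R * R -> 'M[R[i]]_(k, l)) p d : U p -> is_dt D f p d -> is_dt U f p d.
Proof. by move=> Up; rewrite (is_dt_open UD Uopen). Qed.

Let dxD k l (f : R * R -> 'M[R[i]]_(k, l)) p d : U p -> is_dx U f p d -> is_dx D f p d.
Proof. by move=> Up; rewrite (is_dx_open UD Uopen). Qed.

Let dtD k l (f : R * R -> 'M[R[i]]_(k, l)) p d : U p -> is_dt U f p d -> is_dt D f p d.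
Proof. by move=> Up; rewrite (is_dt_open UD Uopen). Qed.

Let T p := invmx (S p).

Let Tx p : U p -> is_dx U T p (- (T p *m rhs_S A1 A2 Pi1 Pi2 G p *m T p)).
Proof. by move=> Up; exact: (is_dxV SU Up (dxU Up (hSx (UD Up)))). Qed.

Let Tt p : U p -> is_dt U T p (- (T p *m rhs_S A1 A2 Pi1 Pi2 F p *m T p)).
Proof. by move=> Up; exact: (is_dtV SU Up (dtU Up (hSt (UD Up)))). Qed.

Let contU k l (f : R * R -> 'M[R[i]]_(k, l)) :
  {within D, continuous f} -> {within U, continuous f}.
Proof. exact: (continuous_open UD Uopen). Qed.

Let CU := continuous_class U.

Let cPi1 : {within U, continuous Pi1}. Proof. exact: contU continuous_Pi1. Qed.
Let cP : {within U, continuous P}. Proof. exact: contU continuous_Pi2. Qed.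

Let cT : {within U, continuous T}.
Proof.
apply/subspace_continuousP => p Up; apply: cvg_invmx; last first.
- by have /subspace_continuousP := contU continuous_S; apply.
- exact: SU.
- by apply: filterS (withinT _ _) => q; exact: SU.
Qed.

Let contFU : all_coefs (fun q => {within U, continuous q}) F.
Proof. by move: contF => [hc hp]; split=> [k /hc/contU|s k /hp/contU]. Qed.

Let C1G : all_coefs (@contC1_t R U m m) G.
Proof.
have h q : {within D, continuous q} /\ C1_t D q -> contC1_t U q.
  move=> [cq [q' [dq cq']]]; split; first exact: (contU cq).
  exists q'; split; last exact: (contU cq').
  by move=> p Up; exact: (dtU Up (dq p (UD Up))).
by move: hG => [hc hp]; split=> [k /hc/h|s k /hp/h].
Qed.

Let dxF : all_coefs (@differentiable_x R U m m) F.
Proof.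
have h q : {within D, continuous q} /\ differentiable_x D q -> differentiable_x U q.
  by move=> [_ dq] p Up; have [l lq] := dq p (UD Up); exists l; exact: (dxU Up lq).
by move: hF => [hc hp]; split=> [k /hc/h|s k /hp/h].
Qed.

Let C1Pi1 : contC1_t U Pi1.
Proof.
split; first exact: cPi1.
exists (rhs_Pi1 A1 Pi1 F); split; last exact: (mxclass_rhs_Pi1 CU).
by move=> p Up; exact: (dtU Up (hPi1t (UD Up))).
Qed.

Let C1P : contC1_t U P.
Proof.
split; first exact: cP.
exists (rhs_Pi2 A2 Pi2 F); split; last exact: (mxclass_rhs_Pi2 CU).
by move=> p Up; exact: (dtU Up (hPi2t (UD Up))).
Qed.

Let C1T : contC1_t U T.
Proof.
split; first exact: cT.
exists (fun p => - (T p *m rhs_S A1 A2 Pi1 Pi2 F p *m T p)); split; first exact: Tt.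
apply: (mxclassN CU); apply: (mxclassM CU); last exact: cT.
by apply: (mxclassM CU); [exact: cT | apply: (mxclass_rhs_S CU)].
Qed.

Let Gtilde := transform A1 A2 Pi1 Pi2 S G.
Let Ftilde := transform A1 A2 Pi1 Pi2 S F.

Lemma transform_G_regular : all_coefs (@contC1_t R U m m) Gtilde.
Proof. exact: (mxclass_transform (contC1_t_class U) A1 A2 C1Pi1 C1P C1T C1G). Qed.

Lemma transform_F_continuous : all_coefs (fun q => {within U, continuous q}) Ftilde.
Proof. exact: (mxclass_transform CU A1 A2 cPi1 cP cT contFU). Qed.

Lemma transform_F_differentiable : all_coefs (@differentiable_x R U m m) Ftilde.
Proof.
apply: (mxclass_transform (differentiable_x_class U) A1 A2 _ _ _ dxF) => p Up.
- by exists (rhs_Pi1 A1 Pi1 G p); exact: (dxU Up (hPi1x (UD Up))).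
- by exists (rhs_Pi2 A2 Pi2 G p); exact: (dxU Up (hPi2x (UD Up))).
- by eexists; apply: Tx.
Qed.

Hypothesis hGF : zero_curvature D G F.
Hypothesis identity : forall p, D p -> A1 *m S p - S p *m A2 = Pi1 p *m P p.

Section DarbouxMatrix.
Variable z : R[i].
Hypotheses (zG : forall s : 'I_(npoles G), z != pole s)
           (zF : forall s : 'I_(npoles F), z != pole s).
Hypotheses (zA1 : A1 - z%:M \in unitmx) (zA2 : A2 - z%:M \in unitmx).

Let R1 := invmx (A1 - z%:M).
Definition darboux p : 'M[R[i]]_m := 1%:M + - (P p *m T p *m R1 *m Pi1 p).
Let W := darboux.
Let phi p := ratmx_eval Gtilde z p *m W p + - (W p *m ratmx_eval G z p).
Let chi p := ratmx_eval Ftilde z p *m W p + - (W p *m ratmx_eval F z p).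

Lemma darboux_dx p : U p -> is_dx U W p (phi p).
Proof.
move=> Up; have Dp := UD Up.
have := is_dxD (is_dx_cst U 1%:M p) (is_dxN (is_dxM (is_dxM
  (is_dxM (dxU Up (hPi2x Dp)) (Tx Up)) (is_dx_cst U R1 p)) (dxU Up (hPi1x Dp)))).
congr is_dx; rewrite add0r mulmx0 addr0 mulmxN.
exact: (darboux_rhs hGA1 hGA2 zG (SU Up) (identity Dp) zA1).
Qed.

Lemma darboux_dt p : U p -> is_dt U W p (chi p).
Proof.
move=> Up; have Dp := UD Up.
have := is_dtD (is_dt_cst U 1%:M p) (is_dtN (is_dtM (is_dtM
  (is_dtM (dtU Up (hPi2t Dp)) (Tt Up)) (is_dt_cst U R1 p)) (dtU Up (hPi1t Dp)))).
congr is_dt; rewrite add0r mulmx0 addr0 mulmxN.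
exact: (darboux_rhs hFA1 hFA2 zF (SU Up) (identity Dp) zA1).
Qed.

Lemma darboux_zero_curvature p (Gt Fx : 'M[R[i]]_m) : U p ->
  is_dt U (ratmx_eval Gtilde z) p Gt -> is_dx U (ratmx_eval Ftilde z) p Fx ->
  Gt - Fx + (ratmx_eval Gtilde z p *m ratmx_eval Ftilde z p
             - ratmx_eval Ftilde z p *m ratmx_eval Gtilde z p) = 0.
Proof.
move=> Up dGt dFx; have Dp := UD Up.
have [Gt0 [Fx0 [dGt0 dFx0 curv]]] := hGF zG zF Dp.
have [cG [Gt' [dG cGt']]] := mxclass_eval (contC1_t_class U) z C1G.
have [cGs [Gs' [dGs cGs']]] := mxclass_eval (contC1_t_class U) z transform_G_regular.
have cW : {within U, continuous W}.
  apply: (mxclassD CU); first exact: (mxclass_cst CU).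
  apply: (mxclassN CU); apply: (mxclassM CU); last exact: cPi1.
  apply: (mxclassM CU); last exact: (mxclass_cst CU).
  by apply: (mxclassM CU).
have cF : {within U, continuous (ratmx_eval F z)} by apply: (mxclass_eval CU).
have cFs : {within U, continuous (ratmx_eval Ftilde z)}.
  exact: (mxclass_eval CU z transform_F_continuous).
have PFt : ProperFilter (within [set y | D (p.1, y)] p.2^') by exact: proper_dt.
have PFx : ProperFilter (within [set y | D (y, p.2)] p.1^') by exact: proper_dx.
have eGs : Gs' p = Gt.
  exact: (cvg_mx_unique PFt (dtD Up (dGs p Up)) (dtD Up dGt)).
have eG : Gt' p = Gt0.
  exact: (cvg_mx_unique PFt (dtD Up (dG p Up)) dGt0).
pose psi q := Gs' q *m W q + ratmx_eval Gtilde z q *m chi q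
  + - (chi q *m ratmx_eval G z q + W q *m Gt' q).
have cchi : {within U, continuous chi}.
  apply: (mxclassD CU); first by apply: (mxclassM CU).
  by apply: (mxclassN CU); apply: (mxclassM CU).
have cpsi : {within U, continuous psi}.
  apply: (mxclassD CU); first by apply: (mxclassD CU); apply: (mxclassM CU).
  by apply: (mxclassN CU); apply: (mxclassD CU); apply: (mxclassM CU).
have phit q : U q -> is_dt U phi q (psi q).
  move=> Uq; apply: is_dtD; first exact: is_dtM (dGs q Uq) (darboux_dt Uq).
  exact: is_dtN (is_dtM (darboux_dt Uq) (dG q Uq)).
have chix := is_dxD (is_dxM dFx (darboux_dx Up))
  (is_dxN (is_dxM (darboux_dx Up) (dxU Up dFx0))).
have e : Fx *m W p + ratmx_eval Ftilde z p *m phi p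
    + - (phi p *m ratmx_eval F z p + W p *m Fx0) = psi p.
  apply: (@mixed_partials R b1 b2 _ _ W phi chi psi p _ Dp).
  - apply: filterS (Uopen Up) => q Uq.
    split; first exact: (dxD Uq (darboux_dx Uq)).
      exact: (dtD Uq (darboux_dt Uq)).
    exact: (dtD Uq (phit q Uq)).
  - move/subspace_continuousP: cpsi => /(_ p Up).
    by rewrite (within_openE UD Uopen).
  - exact: (dxD Up chix).
have WV := mul_WV (mulmxV (SU Up)) (mulVmx (SU Up)) (identity Dp)
  (mulVmx zA1) (mulmxV zA2).
apply: (zero_curvature_transport WV _ curv).
by rewrite -eGs -eG; exact: esym e.
Qed.

End DarbouxMatrix.

(** The left-hand side is a rational function of [z] which vanishes outside the
    poles and the spectra of [A1] and [A2], hence by continuity outside the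
    poles. *)
Lemma transform_zero_curvature : zero_curvature U Gtilde Ftilde.
Proof.
move=> z0 p zG zF Up.
have dtGs : all_coefs (fun q => exists l, is_dt U q p l) Gtilde.
  have [hc hp] := transform_G_regular; split=> [k /hc|s k /hp].
    by move=> [_ [q' [dq _]]]; exists (q' p); apply: dq.
  by move=> [_ [q' [dq _]]]; exists (q' p); apply: dq.
have dxFs : all_coefs (fun q => exists l, is_dx U q p l) Ftilde.
  have [hc hp] := transform_F_differentiable.
  by split=> [k /hc|s k /hp] h; apply: h.
have [G' poleG' dG'] : exists2 G' : ratmx R m,
    forall z, (forall s : 'I_(npoles Gtilde), z != pole s) ->
      forall s : 'I_(npoles G'), z != pole s
  & forall z, is_dt U (ratmx_eval Gtilde z) p (ratmx_eval G' z p).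
  apply: (ratmx_derivative (Der := fun f l => is_dt U f p l) _ _ _ _ p dtGs).
  - exact: is_dt_cst.
  - by move=> f g l k; apply: is_dtD.
  - by move=> f l; apply: is_dtN.
  - move=> c f l df; have := is_dtM (is_dt_cst U c%:M p) df.
    by rewrite mul0mx add0r mul_scalar_mx; congr is_dt; apply/funext => q; rewrite mul_scalar_mx.
have [F' poleF' dF'] : exists2 F' : ratmx R m,
    forall z, (forall s : 'I_(npoles Ftilde), z != pole s) ->
      forall s : 'I_(npoles F'), z != pole s
  & forall z, is_dx U (ratmx_eval Ftilde z) p (ratmx_eval F' z p).
  apply: (ratmx_derivative (Der := fun f l => is_dx U f p l) _ _ _ _ p dxFs).
  - exact: is_dx_cst.
  - by move=> f g l k; apply: is_dxD.
  - by move=> f l; apply: is_dxN.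
  - move=> c f l df; have := is_dxM (is_dx_cst U c%:M p) df.
    by rewrite mul0mx add0r mul_scalar_mx; congr is_dx; apply/funext => q; rewrite mul_scalar_mx.
exists (ratmx_eval G' z0 p), (ratmx_eval F' z0 p); split; [exact: dG' | exact: dF' |].
have cGs := ratmx_eval_continuous (p := p) zG.
have cFs := ratmx_eval_continuous (p := p) zF.
have cG' := ratmx_eval_continuous (p := p) (poleG' z0 zG).
have cF' := ratmx_eval_continuous (p := p) (poleF' z0 zF).
apply: (cvg_mx_unique (Proper_dnbhs_numFieldType z0)
  (f := fun z => ratmx_eval G' z p + - ratmx_eval F' z p
    + (ratmx_eval Gtilde z p *m ratmx_eval Ftilde z p
       + - (ratmx_eval Ftilde z p *m ratmx_eval Gtilde z p)))).
  exact: (cvg_mxD (cvg_mxD cG' (cvg_mxN cF'))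
    (cvg_mxD (cvg_mxM cGs cFs) (cvg_mxN (cvg_mxM cFs cGs)))).
apply: (cvg_near_eq (f := fun=> (0 : 'M[R[i]]_m))); last exact: cvg_cst.
have nG : \forall z \near z0^', forall s : 'I_(npoles G), z != pole s.
  by apply: filter_forall => s; exact: near_neq.
have nF : \forall z \near z0^', forall s : 'I_(npoles F), z != pole s.
  by apply: filter_forall => s; exact: near_neq.
near=> z; apply/esym.
have zG' : forall s : 'I_(npoles G), z != pole s by near: z.
have zF' : forall s : 'I_(npoles F), z != pole s by near: z.
have zA1 : A1 - z%:M \in unitmx by near: z; exact: near_unitmx_sub.
have zA2 : A2 - z%:M \in unitmx by near: z; exact: near_unitmx_sub.
exact: (darboux_zero_curvature zG' zF' zA1 zA2 Up (dG' z) (dF' z)).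
Unshelve. all: by end_near. Qed.

End Main.

Theorem theorem4p2 (R : realType) (b1 b2 : \bar R)
    (hb1 : (0 < b1)%E) (hb2 : (0 < b2)%E)
    (m n : nat) (G F : ratmx R m)
    (hG : all_coefs
            (fun q => {within domain b1 b2, continuous q} /\
                      C1_t (domain b1 b2) q) G)
    (hF : all_coefs
            (fun q => {within domain b1 b2, continuous q} /\
                      differentiable_x (domain b1 b2) q) F)
    (hGF : zero_curvature (domain b1 b2) G F)
    (A1 A2 : 'M[R[i]]_n)
    (hGA1 : poles_avoid_spectrum G A1) (hGA2 : poles_avoid_spectrum G A2)
    (hFA1 : poles_avoid_spectrum F A1) (hFA2 : poles_avoid_spectrum F A2)
    (Pi1 Pi2 : R * R -> 'M[R[i]]_(n, m)) (S : R * R -> 'M[R[i]]_n)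
    (hS0 : A1 *m S (0, 0) - S (0, 0) *m A2 = Pi1 (0, 0) *m (Pi2 (0, 0)) ^t*)
    (hPi1x : forall p, domain b1 b2 p ->
       is_dx (domain b1 b2) Pi1 p (rhs_Pi1 A1 Pi1 G p))
    (hPi2x : forall p, domain b1 b2 p ->
       is_dx (domain b1 b2) (fun p => (Pi2 p) ^t*) p (rhs_Pi2 A2 Pi2 G p))
    (hSx : forall p, domain b1 b2 p ->
       is_dx (domain b1 b2) S p (rhs_S A1 A2 Pi1 Pi2 G p))
    (hPi1t : forall p, domain b1 b2 p ->
       is_dt (domain b1 b2) Pi1 p (rhs_Pi1 A1 Pi1 F p))
    (hPi2t : forall p, domain b1 b2 p ->
       is_dt (domain b1 b2) (fun p => (Pi2 p) ^t*) p (rhs_Pi2 A2 Pi2 F p))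
    (hSt : forall p, domain b1 b2 p ->
       is_dt (domain b1 b2) S p (rhs_S A1 A2 Pi1 Pi2 F p)) :
  let DS := regular_points (domain b1 b2) S in
  let Gtilde := transform A1 A2 Pi1 Pi2 S G in
  let Ftilde := transform A1 A2 Pi1 Pi2 S F in
  [/\ all_coefs (fun q => {within DS, continuous q} /\ C1_t DS q) Gtilde,
      all_coefs (fun q => {within DS, continuous q}) Ftilde
    & zero_curvature DS Gtilde Ftilde].
Proof.
have hGA1' := offspecP hGA1; have hGA2' := offspecP hGA2.
have hFA1' := offspecP hFA1; have hFA2' := offspecP hFA2.
have D0 : domain b1 b2 (0, 0) by split; split.
have identity := operator_identity hGA1' hGA2' hFA1' hFA2'
  hPi1x hPi2x hSx hPi1t hPi2t hSt D0 hS0.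
split.
- exact: (transform_G_regular hG hF hPi1x hPi2x hSx hPi1t hPi2t hSt).
- exact: (transform_F_continuous hG hF hPi1x hPi2x hSx hPi1t hPi2t hSt).
- exact: (transform_zero_curvature hG hF hGA1' hGA2' hFA1' hFA2'
    hPi1x hPi2x hSx hPi1t hPi2t hSt hGF identity).
Qed.
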